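(* Let $f:\mathbb{B}\to\mathbb{H}$ be an arbitrary function and assume that the $3\times3$ dual Pick matrices $\widetilde P_f(z_1,z_2,z_3)$ are positive semidefinite for all $(z_1,z_2,z_3)\in\mathbb{B}^3$. Then there is a unique formal power series $g\in\mathcal{QS}$ such that $f(\alpha)=g^{e_r}(\alpha)$ for all $\alpha\in\mathbb{B}$.
   Context: $\mathbb{H}$ denotes the real quaternions, $\bar\alpha$ the quaternionic conjugate, $|\alpha|^2=\alpha\bar\alpha$, $\mathbb{B}=\{\alpha\in\mathbb{H}:|\alpha|<1\}$. The dual Pick matrix is $\widetilde P_f(z_1,\dots,z_n)=\Big[\sum_{k=0}^\infty \bar z_i^{\,k}(1-\overline{f(z_i)}f(z_j))z_j^k\Big]_{i,j=1}^n$. A quaternionic matrix $A$ is positive semidefinite if $A=A^*$ and $x^*Ax\ge0$ for all quaternionic vectors $x$. $\mathbb{H}[[z]]$ denotes formal power series $g(z)=\sum_{k\ge0}z^kg_k$ in a variable $z$ commuting with the coefficients $g_k\in\mathbb{H}$, with $\limsup_k\sqrt[k]{|g_k|}\le1$. The right evaluation is $g^{e_r}(\alpha)=\sum_{k\ge0}g_k\alpha^k$ and the left evaluation is $g^{e_\ell}(\alpha)=\sum_{k\ge0}\alpha^kg_k$. For such $g$ let $T_n(g)$ be the $n\times n$ lower triangular Toeplitz matrix with $(i,j)$ entry $g_{i-j}$ for $i\ge j$ and $0$ otherwise. The Schur class $\mathcal{QS}$ is the set of $g\in\mathbb{H}[[z]]$ such that $T_n(g)$ is contractive (i.e. $I_n-T_n(g)T_n(g)^*$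 is positive semidefinite) for all $n\ge1$; equivalently (a known result), $|g^{e_\ell}(\alpha)|\le1$ for all $\alpha\in\mathbb{B}$, equivalently $|g^{e_r}(\alpha)|\le 1$ for all $\alpha\in\mathbb{B}$. *)

(* Defs.v *)
From Stdlib Require Import Reals Lra.
Open Scope R_scope.

Record quat := mkQ { qr : R; qi : R; qj : R; qk : R }.

Definition q0 : quat := mkQ 0 0 0 0.
Definition q1 : quat := mkQ 1 0 0 0.
Definition qadd (a b : quat) : quat :=
  mkQ (qr a + qr b) (qi a + qi b) (qj a + qj b) (qk a + qk b).
Definition qopp (a : quat) : quat := mkQ (- qr a) (- qi a) (- qj a) (- qk a).
Definition qsub (a b : quat) : quat := qadd a (qopp b).
(** Hamilton product: i^2 = j^2 = k^2 = ijk = -1 *)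
Definition qmul (a b : quat) : quat :=
  mkQ (qr a * qr b - qi a * qi b - qj a * qj b - qk a * qk b)
      (qr a * qi b + qi a * qr b + qj a * qk b - qk a * qj b)
      (qr a * qj b - qi a * qk b + qj a * qr b + qk a * qi b)
      (qr a * qk b + qi a * qj b - qj a * qi b + qk a * qr b).
Definition qconj (a : quat) : quat := mkQ (qr a) (- qi a) (- qj a) (- qk a).
Definition qnorm (a : quat) : R :=
  sqrt (qr a ^ 2 + qi a ^ 2 + qj a ^ 2 + qk a ^ 2).
Fixpoint qpow (a : quat) (k : nat) : quat :=
  match k with O => q1 | S k' => qmul (qpow a k') a end.

Fixpoint qsumn (n : nat) (f : nat -> quat) : quat :=
  match n with O => q0 | S m => qadd (qsumn m f) (f m) end.

(** [qseries a s] : the series sum_{k>=0} a k converges (componentwise,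
    equivalently in the quaternionic norm) to s. *)
Definition qseries (a : nat -> quat) (s : quat) : Prop :=
  Un_cv (fun n => sum_f_R0 (fun k => qr (a k)) n) (qr s) /\
  Un_cv (fun n => sum_f_R0 (fun k => qi (a k)) n) (qi s) /\
  Un_cv (fun n => sum_f_R0 (fun k => qj (a k)) n) (qj s) /\
  Un_cv (fun n => sum_f_R0 (fun k => qk (a k)) n) (qk s).

Definition in_ball (a : quat) : Prop := qnorm a < 1.

(** n x n quaternionic matrices, represented by their entries (i,j), i,j < n *)
Definition qmat := nat -> nat -> quat.

Definition qpsd (n : nat) (A : qmat) : Prop :=
  (forall i j, (i < n)%nat -> (j < n)%nat -> A i j = qconj (A j i)) /\
  (forall x : nat -> quat,
     let v := qsumn n (fun i => qsumn n (fun j => qmul (qmul (qconj (x i)) (A i j)) (x j))) in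
     qi v = 0 /\ qj v = 0 /\ qk v = 0 /\ 0 <= qr v).

(** Formal power series g(z) = sum z^k g_k, given by its coefficients,
    with limsup_k |g_k|^{1/k} <= 1, i.e. for every eps > 0, eventually
    |g_k| <= (1+eps)^k. *)
Definition radius_ge1 (g : nat -> quat) : Prop :=
  forall eps, 0 < eps -> exists N, forall k, (N <= k)%nat -> qnorm (g k) <= (1 + eps) ^ k.

Definition toeplitz (g : nat -> quat) : qmat :=
  fun i j => if Nat.leb j i then g (i - j)%nat else q0.

Definition id_minus_TTstar (n : nat) (T : qmat) : qmat :=
  fun i j => qsub (if Nat.eqb i j then q1 else q0)
                  (qsumn n (fun l => qmul (T i l) (qconj (T j l)))).

Definition QS (g : nat -> quat) : Prop :=
  radius_ge1 g /\
  forall n, (1 <= n)%nat -> qpsd n (id_minus_TTstar n (toeplitz g)).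

Definition eval_r (g : nat -> quat) (a : quat) (s : quat) : Prop :=
  qseries (fun k => qmul (g k) (qpow a k)) s.

Definition dual_pick_term (f : quat -> quat) (z : nat -> quat) (i j k : nat) : quat :=
  qmul (qmul (qpow (qconj (z i)) k) (qsub q1 (qmul (qconj (f (z i))) (f (z j)))))
       (qpow (z j) k).

Definition pts3 (z1 z2 z3 : quat) : nat -> quat :=
  fun i => match i with O => z1 | S O => z2 | _ => z3 end.

Definition dual_pick3_psd (f : quat -> quat) (z1 z2 z3 : quat) : Prop :=
  exists P : qmat,
    (forall i j, (i < 3)%nat -> (j < 3)%nat ->
       qseries (dual_pick_term f (pts3 z1 z2 z3) i j) (P i j)) /\
    qpsd 3 P.

(* Main.v *)
(** Writing the quadratic form of the dual Pick matrix as
    [sum_k (|sum_i z_i^k x_i|^2 - |sum_i f(z_i) z_i^k x_i|^2)], positivity says that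
    [sum_i z_i^k x_i |-> sum_i f(z_i) z_i^k x_i] is contractive in [l^2].  On a complex
    slice, take for [x_i] the weights of a second divided difference at three points:
    the term [k = 0] bounds the second divided differences of [f] on every disc
    [|z| <= r < 1].  Such a bound yields, by telescoping finite sums over roots of
    unity, a discrete Cauchy formula, so that the polynomials interpolating [f] at the
    [N]-th roots of unity converge to [f] at rate [1/N]; hence [f] is a power series
    [sum_k g_k z^k] on each slice.  The slices share the real axis, so [g] does not
    depend on the slice.

    For [y <> 0], [sum_m g_m y z^m = f(y z y^-1) y] has norm at most [|y|].  Applying
    this with [y = sum_k x_k z^k] and averaging over roots of unity (Parseval) gives
    [|T_n(g) x| <= |x|], and then [T_n(g)^*] is contractive as well. *)
Require Import Defs.
From Stdlib Require Import Reals Lra Lia.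
From Coquelicot Require Import Coquelicot.
Open Scope R_scope.

(** * Quaternion algebra *)

(** The obstacle is that [f] is arbitrary: on a slice neither continuity nor differentiability is
    given, so contour integrals are replaced by finite sums with explicit errors. While the [N]-th
    roots of unity are contracted onto [z], about [N^2] triangles with sides [O(1/N)] are swept; the
    three-point bound gives each an error of third order, so [O(1/N)] remains. The side of
    multiplication matters. The Pick form contains [f(z_i) z_i^k x_i], so a slice acts on values
    from the right, and Parseval and Cauchy estimates hold for quaternionic coefficients. Between
    slices nothing commutes: [y z y^-1] leaves the slice of [z], so the Toeplitz estimate draws on
    [|f| <= 1] in the whole ball. The constant obtained for divided differences on [|z| <= r] grows
    without bound as [r] tends to 1. The coefficient bound [|g_k| r^k <= 1] comes instead from
    [|f| <= 1], and therefore survives that limit. *)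

Lemma quat_ext (a b : quat) :
  qr a = qr b -> qi a = qi b -> qj a = qj b -> qk a = qk b -> a = b.
Proof. destruct a, b; simpl; intros; subst; reflexivity. Qed.

Ltac qunfold :=
  unfold qsub, qadd, qopp, qmul, qconj, q0, q1; cbn [qr qi qj qk].
Ltac qring := apply quat_ext; qunfold; ring.

Lemma qmulA a b c : qmul (qmul a b) c = qmul a (qmul b c).
Proof. qring. Qed.

Lemma qmul1l a : qmul q1 a = a.
Proof. qring. Qed.

Lemma qmul1r a : qmul a q1 = a.
Proof. qring. Qed.

Lemma qmul_subl a b c : qmul (qsub a b) c = qsub (qmul a c) (qmul b c).
Proof. qring. Qed.

Lemma qmul_subr a b c : qmul a (qsub b c) = qsub (qmul a b) (qmul a c).
Proof. qring. Qed.

Lemma qconj_mul a b : qconj (qmul a b) = qmul (qconj b) (qconj a).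
Proof. qring. Qed.

Lemma qconjK a : qconj (qconj a) = a.
Proof. qring. Qed.

(** The real inner product, that is the real part of [conj(a) b]. Parseval and the adjoint argument
    are run with this real form. *)
Definition qdot (a b : quat) : R :=
  qr a * qr b + qi a * qi b + qj a * qj b + qk a * qk b.
Definition qnrm2 (a : quat) : R := qdot a a.

Lemma qnrm2_ge0 a : 0 <= qnrm2 a.
Proof. unfold qnrm2, qdot; nra. Qed.

Lemma qnorm_sqr a : qnorm a * qnorm a = qnrm2 a.
Proof.
  unfold qnorm. rewrite sqrt_sqrt; [unfold qnrm2, qdot; ring | nra].
Qed.

Lemma qnorm_ge0 a : 0 <= qnorm a.
Proof. apply sqrt_pos. Qed.

Lemma qnorm_unique a x : 0 <= x -> qnrm2 a = x * x -> qnorm a = x.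
Proof.
  intros Hx H. pose proof (qnorm_sqr a). pose proof (qnorm_ge0 a). nra.
Qed.

Lemma qnorm_le a x : 0 <= x -> qnrm2 a <= x * x -> qnorm a <= x.
Proof.
  intros Hx H. pose proof (qnorm_sqr a). pose proof (qnorm_ge0 a). nra.
Qed.

(** Euler's four-square identity. *)
Lemma qnrm2_mul a b : qnrm2 (qmul a b) = qnrm2 a * qnrm2 b.
Proof. unfold qnrm2, qdot; qunfold; ring. Qed.

Lemma qnorm_mul a b : qnorm (qmul a b) = qnorm a * qnorm b.
Proof.
  apply qnorm_unique.
  - apply Rmult_le_pos; apply qnorm_ge0.
  - rewrite qnrm2_mul, <- !qnorm_sqr; ring.
Qed.

Lemma qnorm0 : qnorm q0 = 0.
Proof. apply qnorm_unique; [lra | unfold qnrm2, qdot; simpl; ring]. Qed.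

Lemma qnorm1 : qnorm q1 = 1.
Proof. apply qnorm_unique; [lra | unfold qnrm2, qdot; simpl; ring]. Qed.

Lemma qnorm_opp a : qnorm (qopp a) = qnorm a.
Proof.
  apply qnorm_unique; [apply qnorm_ge0|].
  rewrite qnorm_sqr. unfold qnrm2, qdot; qunfold; ring.
Qed.

Lemma qnorm_sub_sym a b : qnorm (qsub a b) = qnorm (qsub b a).
Proof. rewrite <- qnorm_opp. f_equal. qring. Qed.

Lemma qdot_le a b : qdot a b <= qnorm a * qnorm b.
Proof.
  assert (H : qdot a b * qdot a b <= (qnorm a * qnorm b) * (qnorm a * qnorm b)).
  { replace ((qnorm a * qnorm b) * (qnorm a * qnorm b))
      with (qnrm2 a * qnrm2 b) by (rewrite <- !qnorm_sqr; ring).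
    rewrite <- (Rplus_0_r (qdot a b * qdot a b)).
    (* Lagrange's identity: the defect in Cauchy-Schwarz is the sum of the squares of the six 2 by 2
       minors. *)
    replace (qnrm2 a * qnrm2 b) with (qdot a b * qdot a b +
      ((qr a * qi b - qi a * qr b)^2 + (qr a * qj b - qj a * qr b)^2 +
       (qr a * qk b - qk a * qr b)^2 + (qi a * qj b - qj a * qi b)^2 +
       (qi a * qk b - qk a * qi b)^2 + (qj a * qk b - qk a * qj b)^2))
      by (unfold qnrm2, qdot; ring).
    apply Rplus_le_compat_l.
    repeat apply Rplus_le_le_0_compat; apply pow2_ge_0. }
  assert (0 <= qnorm a * qnorm b) by (apply Rmult_le_pos; apply qnorm_ge0).
  nra.
Qed.

Lemma qnorm_add_le a b : qnorm (qadd a b) <= qnorm a + qnorm b.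
Proof.
  pose proof (qnorm_ge0 a). pose proof (qnorm_ge0 b).
  apply qnorm_le; [lra|].
  replace (qnrm2 (qadd a b)) with (qnrm2 a + qnrm2 b + 2 * qdot a b)
    by (unfold qnrm2, qdot; qunfold; ring).
  rewrite <- !qnorm_sqr. pose proof (qdot_le a b). nra.
Qed.

Lemma qnorm_triangle a b c :
  qnorm (qsub a c) <= qnorm (qsub a b) + qnorm (qsub b c).
Proof.
  replace (qsub a c) with (qadd (qsub a b) (qsub b c)) by qring.
  apply qnorm_add_le.
Qed.

Lemma qnorm_le_sub a b : qnorm a <= qnorm b + qnorm (qsub a b).
Proof.
  replace a with (qadd b (qsub a b)) at 1 by qring. apply qnorm_add_le.
Qed.

Lemma qnorm_eq0 a : qnorm a = 0 -> a = q0.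
Proof.
  intros H. pose proof (qnorm_sqr a) as E. rewrite H in E.
  unfold qnrm2, qdot in E. apply quat_ext; simpl; nra.
Qed.

Lemma qr_le_qnorm a : Rabs (qr a) <= qnorm a.
Proof.
  pose proof (qnorm_sqr a). pose proof (qnorm_ge0 a).
  unfold qnrm2, qdot in *. apply Rabs_le. split; nra.
Qed.

Lemma qi_le_qnorm a : Rabs (qi a) <= qnorm a.
Proof.
  pose proof (qnorm_sqr a). pose proof (qnorm_ge0 a).
  unfold qnrm2, qdot in *. apply Rabs_le. split; nra.
Qed.

Lemma qj_le_qnorm a : Rabs (qj a) <= qnorm a.
Proof.
  pose proof (qnorm_sqr a). pose proof (qnorm_ge0 a).
  unfold qnrm2, qdot in *. apply Rabs_le. split; nra.
Qed.

Lemma qk_le_qnorm a : Rabs (qk a) <= qnorm a.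
Proof.
  pose proof (qnorm_sqr a). pose proof (qnorm_ge0 a).
  unfold qnrm2, qdot in *. apply Rabs_le. split; nra.
Qed.

Lemma qnorm_le_components a :
  qnorm a <= Rabs (qr a) + Rabs (qi a) + Rabs (qj a) + Rabs (qk a).
Proof.
  pose proof (Rabs_pos (qr a)). pose proof (Rabs_pos (qi a)).
  pose proof (Rabs_pos (qj a)). pose proof (Rabs_pos (qk a)).
  apply qnorm_le; [lra|].
  unfold qnrm2, qdot.
  assert (E : forall x, x * x = Rabs x * Rabs x).
  { intros x. change (Rsqr x = Rsqr (Rabs x)). apply Rsqr_abs. }
  rewrite (E (qr a)), (E (qi a)), (E (qj a)), (E (qk a)). nra.
Qed.

Lemma qpow_comm a k : qmul a (qpow a k) = qmul (qpow a k) a.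
Proof.
  induction k as [|k IH]; simpl; [qring|].
  now rewrite <- qmulA, IH.
Qed.

Lemma qpow_add a k l : qpow a (k + l) = qmul (qpow a k) (qpow a l).
Proof.
  induction l as [|l IH]; [rewrite Nat.add_0_r; simpl; qring|].
  rewrite Nat.add_succ_r; simpl. now rewrite IH, qmulA.
Qed.

Lemma qpow_conj a k : qpow (qconj a) k = qconj (qpow a k).
Proof.
  induction k as [|k IH]; simpl; [qring|].
  now rewrite IH, <- qconj_mul, qpow_comm.
Qed.

Lemma qnorm_pow a k : qnorm (qpow a k) = qnorm a ^ k.
Proof.
  induction k as [|k IH]; simpl; [apply qnorm1|].
  rewrite qnorm_mul, IH; ring.
Qed.

(** * Finite sums *)

Fixpoint rsumn (n : nat) (f : nat -> R) : R :=
  match n with O => 0 | S m => rsumn m f + f m end.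

Fixpoint csumn (n : nat) (f : nat -> C) : C :=
  match n with O => RtoC 0 | S m => Cplus (csumn m f) (f m) end.

Lemma rsumn_ext n f g :
  (forall k, (k < n)%nat -> f k = g k) -> rsumn n f = rsumn n g.
Proof.
  induction n as [|n IH]; simpl; intros H; [reflexivity|].
  rewrite IH by (intros; apply H; lia). now rewrite H by lia.
Qed.

Lemma rsumn_le n f g :
  (forall k, (k < n)%nat -> f k <= g k) -> rsumn n f <= rsumn n g.
Proof.
  induction n as [|n IH]; simpl; intros H; [lra|].
  apply Rplus_le_compat; [apply IH; intros; apply H | apply H]; lia.
Qed.

Lemma rsumn_add n f g : rsumn n (fun k => f k + g k) = rsumn n f + rsumn n g.
Proof. induction n as [|n IH]; simpl; [ring|rewrite IH; ring]. Qed.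

Lemma rsumn_scal n c f : rsumn n (fun k => c * f k) = c * rsumn n f.
Proof. induction n as [|n IH]; simpl; [ring|rewrite IH; ring]. Qed.

Lemma rsumn_const n c : rsumn n (fun _ => c) = INR n * c.
Proof.
  induction n as [|n IH]; [simpl; ring|].
  rewrite S_INR. simpl. rewrite IH; ring.
Qed.

Lemma rsumn_exch n m f :
  rsumn n (fun i => rsumn m (fun j => f i j)) =
  rsumn m (fun j => rsumn n (fun i => f i j)).
Proof.
  induction n as [|n IH]; simpl.
  - induction m as [|m IHm]; simpl; [reflexivity|rewrite <- IHm; ring].
  - now rewrite IH, rsumn_add.
Qed.

Lemma rsumn_ge0 n f : (forall k, (k < n)%nat -> 0 <= f k) -> 0 <= rsumn n f.
Proof.
  intros H. replace 0 with (rsumn n (fun _ => 0)) by (rewrite rsumn_const; ring).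
  now apply rsumn_le.
Qed.

Lemma rsumn_incr n m f :
  (forall k, 0 <= f k) -> (n <= m)%nat -> rsumn n f <= rsumn m f.
Proof.
  intros H Hnm. induction Hnm as [|m Hnm IH]; [lra|].
  simpl. specialize (H m). lra.
Qed.

Lemma rsumn_delta n m f : (m < n)%nat ->
  (forall k, (k < n)%nat -> k <> m -> f k = 0) -> rsumn n f = f m.
Proof.
  induction n as [|n IH]; intros Hm H; [lia|]. simpl.
  destruct (Nat.eq_dec m n) as [->|Hne].
  - replace (rsumn n f) with (rsumn n (fun _ => 0)).
    + rewrite rsumn_const; ring.
    + apply rsumn_ext. intros k Hk. symmetry; apply H; lia.
  - rewrite IH; [rewrite (H n) by lia; ring | lia | intros; apply H; lia].
Qed.

Lemma qsumn_ext n f g :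
  (forall k, (k < n)%nat -> f k = g k) -> qsumn n f = qsumn n g.
Proof.
  induction n as [|n IH]; simpl; intros H; [reflexivity|].
  rewrite IH by (intros; apply H; lia). now rewrite H by lia.
Qed.

Lemma qsumn_add n f g :
  qsumn n (fun k => qadd (f k) (g k)) = qadd (qsumn n f) (qsumn n g).
Proof. induction n as [|n IH]; simpl; [qring|rewrite IH; qring]. Qed.

Lemma qsumn_sub n f g :
  qsumn n (fun k => qsub (f k) (g k)) = qsub (qsumn n f) (qsumn n g).
Proof. induction n as [|n IH]; simpl; [qring|rewrite IH; qring]. Qed.

Lemma qsumn_mull n c f : qsumn n (fun k => qmul c (f k)) = qmul c (qsumn n f).
Proof. induction n as [|n IH]; simpl; [qring|rewrite IH; qring]. Qed.

Lemma qsumn_mulr n c f : qsumn n (fun k => qmul (f k) c) = qmul (qsumn n f) c.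
Proof. induction n as [|n IH]; simpl; [qring|rewrite IH; qring]. Qed.

Lemma qsumn_0 n : qsumn n (fun _ => q0) = q0.
Proof. induction n as [|n IH]; simpl; [reflexivity|rewrite IH; qring]. Qed.

Lemma qsumn_exch n m f :
  qsumn n (fun i => qsumn m (fun j => f i j)) =
  qsumn m (fun j => qsumn n (fun i => f i j)).
Proof.
  induction n as [|n IH]; simpl.
  - now rewrite qsumn_0.
  - now rewrite IH, qsumn_add.
Qed.

Lemma qsumn_telescope n f :
  qsumn n (fun k => qsub (f (S k)) (f k)) = qsub (f n) (f O).
Proof. induction n as [|n IH]; simpl; [qring|rewrite IH; qring]. Qed.

Lemma qsumn_split n m f :
  qsumn (n + m) f = qadd (qsumn n f) (qsumn m (fun k => f (n + k)%nat)).
Proof.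
  induction m as [|m IH]; [rewrite Nat.add_0_r; simpl; qring|].
  rewrite Nat.add_succ_r; simpl. rewrite IH; qring.
Qed.

Lemma qsumn_conj n f : qconj (qsumn n f) = qsumn n (fun k => qconj (f k)).
Proof. induction n as [|n IH]; simpl; [qring|rewrite <- IH; qring]. Qed.

Lemma qsumn_norm_le n f : qnorm (qsumn n f) <= rsumn n (fun k => qnorm (f k)).
Proof.
  induction n as [|n IH]; simpl; [rewrite qnorm0; lra|].
  eapply Rle_trans; [apply qnorm_add_le|]. lra.
Qed.

Lemma qsumn_norm_le_const n f c :
  (forall k, (k < n)%nat -> qnorm (f k) <= c) ->
  qnorm (qsumn n f) <= INR n * c.
Proof.
  intros H. eapply Rle_trans; [apply qsumn_norm_le|].
  rewrite <- rsumn_const. now apply rsumn_le.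
Qed.

Lemma qr_qsumn n f : qr (qsumn n f) = rsumn n (fun k => qr (f k)).
Proof. induction n as [|n IH]; simpl; [reflexivity|now rewrite IH]. Qed.

Lemma qi_qsumn n f : qi (qsumn n f) = rsumn n (fun k => qi (f k)).
Proof. induction n as [|n IH]; simpl; [reflexivity|now rewrite IH]. Qed.

Lemma qj_qsumn n f : qj (qsumn n f) = rsumn n (fun k => qj (f k)).
Proof. induction n as [|n IH]; simpl; [reflexivity|now rewrite IH]. Qed.

Lemma qk_qsumn n f : qk (qsumn n f) = rsumn n (fun k => qk (f k)).
Proof. induction n as [|n IH]; simpl; [reflexivity|now rewrite IH]. Qed.

Lemma qdot_qsumn_r n a f : qdot a (qsumn n f) = rsumn n (fun k => qdot a (f k)).
Proof.
  induction n as [|n IH]; simpl; [unfold qdot; simpl; ring|].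
  rewrite <- IH. unfold qdot; simpl; ring.
Qed.

Lemma qdot_sym a b : qdot a b = qdot b a.
Proof. unfold qdot; ring. Qed.

Lemma qdot_qsumn_l n a f : qdot (qsumn n f) a = rsumn n (fun k => qdot (f k) a).
Proof.
  rewrite qdot_sym, qdot_qsumn_r. apply rsumn_ext. intros; apply qdot_sym.
Qed.

Lemma csumn_ext n f g :
  (forall k, (k < n)%nat -> f k = g k) -> csumn n f = csumn n g.
Proof.
  induction n as [|n IH]; simpl; intros H; [reflexivity|].
  rewrite IH by (intros; apply H; lia). now rewrite H by lia.
Qed.

Lemma csumn_geometric n v :
  Cmult (Cminus v 1) (csumn n (fun k => Cpow v k)) = Cminus (Cpow v n) 1.
Proof.
  induction n as [|n IH]; simpl; [ring|].
  rewrite Cmult_plus_distr_l, IH. ring.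
Qed.

Lemma csumn_delta n m f : (m < n)%nat ->
  (forall k, (k < n)%nat -> k <> m -> f k = RtoC 0) -> csumn n f = f m.
Proof.
  induction n as [|n IH]; intros Hm H; [lia|]. simpl.
  destruct (Nat.eq_dec m n) as [->|Hne].
  - replace (csumn n f) with (RtoC 0); [ring|].
    assert (E : forall k, (k <= n)%nat -> csumn k f = RtoC 0).
    { induction k as [|k IHk]; intros Hk; [reflexivity|]. simpl.
      rewrite IHk, H by lia. ring. }
    now rewrite E by lia.
  - rewrite IH; [rewrite (H n) by lia; ring | lia | intros; apply H; lia].
Qed.

Lemma csumn_exch n m f :
  csumn n (fun i => csumn m (fun j => f i j)) =
  csumn m (fun j => csumn n (fun i => f i j)).
Proof.
  induction n as [|n IH]; simpl.
  - induction m as [|m IHm]; simpl; [reflexivity|rewrite <- IHm; ring].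
  - rewrite IH. clear IH. induction m as [|m IHm]; simpl; [ring|].
    rewrite <- IHm. ring.
Qed.

Lemma csumn_mull n c f :
  csumn n (fun k => Cmult c (f k)) = Cmult c (csumn n f).
Proof. induction n as [|n IH]; simpl; [ring|rewrite IH; ring]. Qed.

Lemma csumn_1 n : csumn n (fun _ => RtoC 1) = RtoC (INR n).
Proof.
  induction n as [|n IH]; [reflexivity|].
  rewrite S_INR, RtoC_plus. simpl. now rewrite IH.
Qed.

(** * Limits of quaternionic sequences *)

Definition qlim (v : nat -> quat) (s : quat) : Prop :=
  forall eps, 0 < eps -> exists N, forall n, (N <= n)%nat ->
    qnorm (qsub (v n) s) < eps.

Lemma sum_f_R0_rsumn f n : sum_f_R0 f n = rsumn (S n) f.
Proof. induction n as [|n IH]; simpl; [ring|rewrite IH; reflexivity]. Qed.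

Lemma qseries_qlim a s : qseries a s <-> qlim (fun n => qsumn n a) s.
Proof.
  split.
  - intros (H1 & H2 & H3 & H4) eps He.
    destruct (H1 (eps / 4)) as [N1 K1]; [lra|].
    destruct (H2 (eps / 4)) as [N2 K2]; [lra|].
    destruct (H3 (eps / 4)) as [N3 K3]; [lra|].
    destruct (H4 (eps / 4)) as [N4 K4]; [lra|].
    (* [sum_f_R0] at [n] has [n + 1] terms while [qsumn n] has [n]: the index is shifted by one and
       the empty sum is excluded. *)
    exists (S (N1 + N2 + N3 + N4)). intros [|n] Hn; [lia|].
    specialize (K1 n ltac:(lia)). specialize (K2 n ltac:(lia)).
    specialize (K3 n ltac:(lia)). specialize (K4 n ltac:(lia)).
    unfold R_dist in *. rewrite sum_f_R0_rsumn in *.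
    rewrite <- qr_qsumn in K1. rewrite <- qi_qsumn in K2.
    rewrite <- qj_qsumn in K3. rewrite <- qk_qsumn in K4.
    eapply Rle_lt_trans; [apply qnorm_le_components|].
    unfold Rminus in *. unfold qsub, qadd, qopp; cbn [qr qi qj qk]. lra.
  - intros H.
    assert (L : forall p : quat -> R,
      (forall q, Rabs (p q) <= qnorm q) ->
      (forall q t, p (qsub q t) = p q - p t) ->
      (forall n, p (qsumn n a) = rsumn n (fun k => p (a k))) ->
      Un_cv (fun n => sum_f_R0 (fun k => p (a k)) n) (p s)).
    { intros p P1 P2 P3 eps He. destruct (H eps He) as [N HN].
      exists N. intros n Hn. unfold R_dist.
      rewrite sum_f_R0_rsumn, <- P3, <- P2.
      eapply Rle_lt_trans; [apply P1|]. apply HN. lia. }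
    repeat split; apply L.
    all: try (intros; reflexivity).
    + apply qr_le_qnorm.
    + intros; apply qr_qsumn.
    + apply qi_le_qnorm.
    + intros; apply qi_qsumn.
    + apply qj_le_qnorm.
    + intros; apply qj_qsumn.
    + apply qk_le_qnorm.
    + intros; apply qk_qsumn.
Qed.

Lemma qlim_ext v w s : (forall n, v n = w n) -> qlim v s -> qlim w s.
Proof.
  intros E H eps He. destruct (H eps He) as [N HN]. exists N.
  intros n Hn. rewrite <- E. now apply HN.
Qed.

Lemma qlim_const c : qlim (fun _ => c) c.
Proof.
  intros eps He. exists O. intros n _.
  replace (qsub c c) with q0 by qring. now rewrite qnorm0.
Qed.

Lemma qlim_add v w s t :
  qlim v s -> qlim w t -> qlim (fun n => qadd (v n) (w n)) (qadd s t).
Proof.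
  intros Hv Hw eps He.
  destruct (Hv (eps / 2)) as [N1 H1]; [lra|].
  destruct (Hw (eps / 2)) as [N2 H2]; [lra|].
  exists (N1 + N2)%nat. intros n Hn.
  specialize (H1 n ltac:(lia)). specialize (H2 n ltac:(lia)).
  replace (qsub (qadd (v n) (w n)) (qadd s t))
    with (qadd (qsub (v n) s) (qsub (w n) t)) by qring.
  eapply Rle_lt_trans; [apply qnorm_add_le|]. lra.
Qed.

Lemma qlim_mul c d v s :
  qlim v s -> qlim (fun n => qmul (qmul c (v n)) d) (qmul (qmul c s) d).
Proof.
  intros Hv eps He.
  pose proof (qnorm_ge0 c). pose proof (qnorm_ge0 d).
  assert (Hcd : 0 <= qnorm c * qnorm d) by (apply Rmult_le_pos; assumption).
  (* The added 1 keeps the divisor positive when [c] or [d] vanishes. *)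
  destruct (Hv (eps / (qnorm c * qnorm d + 1))) as [N HN].
  { apply Rdiv_lt_0_compat; lra. }
  exists N. intros n Hn. specialize (HN n Hn).
  replace (qsub (qmul (qmul c (v n)) d) (qmul (qmul c s) d))
    with (qmul (qmul c (qsub (v n) s)) d) by qring.
  rewrite !qnorm_mul.
  pose proof (qnorm_ge0 (qsub (v n) s)).
  apply Rle_lt_trans with ((qnorm c * qnorm d + 1) * qnorm (qsub (v n) s)); [nra|].
  replace eps with ((qnorm c * qnorm d + 1) * (eps / (qnorm c * qnorm d + 1)))
    by (field; lra).
  apply Rmult_lt_compat_l; lra.
Qed.

Lemma qlim_qsumn n (v : nat -> nat -> quat) (s : nat -> quat) :
  (forall i, (i < n)%nat -> qlim (v i) (s i)) ->
  qlim (fun m => qsumn n (fun i => v i m)) (qsumn n s).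
Proof.
  induction n as [|n IH]; simpl; intros H; [apply qlim_const|].
  apply qlim_add; [apply IH; intros; apply H; lia | apply H; lia].
Qed.

Lemma qlim_shift v s k : qlim (fun n => v (n + k)%nat) s -> qlim v s.
Proof.
  intros H eps He. destruct (H eps He) as [N HN].
  exists (N + k)%nat. intros n Hn.
  replace n with ((n - k) + k)%nat by lia. apply HN. lia.
Qed.

(** Closed balls are closed; estimates pass to limits of quaternions in this form. *)
Lemma qlim_norm_sub_le v s c b N :
  qlim v s -> (forall n, (N <= n)%nat -> qnorm (qsub (v n) c) <= b) ->
  qnorm (qsub s c) <= b.
Proof.
  intros Hv Hb. apply le_epsilon. intros eps He.
  destruct (Hv eps He) as [M HM].
  specialize (HM (N + M)%nat ltac:(lia)). specialize (Hb (N + M)%nat ltac:(lia)).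
  pose proof (qnorm_triangle s (v (N + M)%nat) c) as T.
  rewrite (qnorm_sub_sym s (v _)) in T. lra.
Qed.

Lemma qlim_unique v s t : qlim v s -> qlim v t -> s = t.
Proof.
  intros Hs Ht.
  assert (E : qsub s t = q0).
  { apply qnorm_eq0. apply Rle_antisym; [|apply qnorm_ge0].
    apply le_epsilon. intros eps He. destruct (Ht eps He) as [N HN].
    rewrite Rplus_0_l. apply (qlim_norm_sub_le v s t eps N Hs).
    intros n Hn. left. now apply HN. }
  replace s with (qadd (qsub s t) t) by qring. rewrite E. qring.
Qed.

Lemma qlim_cauchy v :
  (forall eps, 0 < eps -> exists N, forall n m, (N <= n)%nat -> (N <= m)%nat ->
     qnorm (qsub (v n) (v m)) < eps) ->
  { s | qlim v s }.
Proof.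
  intros H.
  assert (L : forall p : quat -> R,
      (forall q, Rabs (p q) <= qnorm q) ->
      (forall q t, p (qsub q t) = p q - p t) ->
      { l | Un_cv (fun n => p (v n)) l }).
  { intros p P1 P2. destruct (Rcomplete.R_complete (fun n => p (v n))) as [l Hl].
    - intros eps He. destruct (H eps He) as [N HN]. exists N.
      intros n m Hn Hm. unfold R_dist. rewrite <- P2.
      eapply Rle_lt_trans; [apply P1|]. apply HN; lia.
    - now exists l. }
  destruct (L qr qr_le_qnorm) as [l1 H1]; [reflexivity|].
  destruct (L qi qi_le_qnorm) as [l2 H2]; [reflexivity|].
  destruct (L qj qj_le_qnorm) as [l3 H3]; [reflexivity|].
  destruct (L qk qk_le_qnorm) as [l4 H4]; [reflexivity|].
  exists (mkQ l1 l2 l3 l4). intros eps He.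
  destruct (H1 (eps / 4)) as [N1 K1]; [lra|].
  destruct (H2 (eps / 4)) as [N2 K2]; [lra|].
  destruct (H3 (eps / 4)) as [N3 K3]; [lra|].
  destruct (H4 (eps / 4)) as [N4 K4]; [lra|].
  exists (N1 + N2 + N3 + N4)%nat. intros n Hn.
  specialize (K1 n ltac:(lia)). specialize (K2 n ltac:(lia)).
  specialize (K3 n ltac:(lia)). specialize (K4 n ltac:(lia)).
  unfold R_dist in *.
  eapply Rle_lt_trans; [apply qnorm_le_components|].
  unfold Rminus in *. unfold qsub, qadd, qopp; cbn [qr qi qj qk]. lra.
Qed.

Lemma pow_le_1 r n : 0 <= r <= 1 -> r ^ n <= 1.
Proof. intros Hr. rewrite <- (pow1 n). now apply pow_incr. Qed.

Lemma pow_small r B eps : 0 <= r < 1 -> 0 <= B -> 0 < eps ->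
  exists N, forall n, (N <= n)%nat -> B * r ^ n < eps.
Proof.
  intros Hr HB He.
  destruct (pow_lt_1_zero r) with (y := eps / (B + 1)) as [N HN].
  { rewrite Rabs_pos_eq; lra. }
  { apply Rdiv_lt_0_compat; lra. }
  exists N. intros n Hn. specialize (HN n Hn).
  pose proof (pow_le r n (proj1 Hr)) as Hp.
  rewrite Rabs_pos_eq in HN by assumption.
  apply Rle_lt_trans with ((B + 1) * r ^ n); [nra|].
  replace eps with ((B + 1) * (eps / (B + 1))) by (field; lra).
  apply Rmult_lt_compat_l; lra.
Qed.

Lemma qsumn_geometric_tail (a : nat -> quat) B r n m :
  0 <= r < 1 -> (forall k, qnorm (a k) <= B * r ^ k) ->
  (n <= m)%nat ->
  qnorm (qsub (qsumn m a) (qsumn n a)) <= B * r ^ n / (1 - r).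
Proof.
  intros Hr Ha Hnm.
  assert (HB : 0 <= B).
  { pose proof (Ha O). pose proof (qnorm_ge0 (a O)). simpl in *. lra. }
  replace m with (n + (m - n))%nat by lia. generalize (m - n)%nat. clear m Hnm.
  intros m. rewrite qsumn_split.
  replace (qsub (qadd (qsumn n a) (qsumn m (fun k => a (n + k)%nat))) (qsumn n a))
    with (qsumn m (fun k => a (n + k)%nat)) by qring.
  pose proof (pow_le r n (proj1 Hr)) as Hp.
  assert (G : forall m, rsumn m (fun k => qnorm (a (n + k)%nat))
      <= B * r ^ n * (1 - r ^ m) / (1 - r)).
  { clear m. induction m as [|m IH]; simpl; [right; field; lra|].
    apply Rle_trans with (B * r ^ n * (1 - r ^ m) / (1 - r) + B * r ^ (n + m)).
    - apply Rplus_le_compat; [exact IH | apply Ha].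
    - right. rewrite pow_add. field. lra. }
  eapply Rle_trans; [apply qsumn_norm_le|]. eapply Rle_trans; [apply G|].
  unfold Rdiv. apply Rmult_le_compat_r.
  - left. apply Rinv_0_lt_compat. lra.
  - pose proof (pow_le r m (proj1 Hr)).
    assert (0 <= B * r ^ n) by (apply Rmult_le_pos; assumption). nra.
Qed.

Lemma qlim_geometric_tail (a : nat -> quat) B r s n :
  0 <= r < 1 -> (forall k, qnorm (a k) <= B * r ^ k) ->
  qlim (fun n => qsumn n a) s ->
  qnorm (qsub s (qsumn n a)) <= B * r ^ n / (1 - r).
Proof.
  intros Hr Ha Hs.
  apply (qlim_norm_sub_le (fun n => qsumn n a) s _ _ n Hs).
  intros m Hm. now apply qsumn_geometric_tail.
Qed.

(** * Complex slices *)

Definition im_unit (u : quat) : Prop :=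
  qi u * qi u + qj u * qj u + qk u * qk u = 1.

(* The copy [R + R u] of the complex numbers; the real part of [u] is ignored. *)
Definition emb (u : quat) (c : C) : quat :=
  mkQ (fst c) (snd c * qi u) (snd c * qj u) (snd c * qk u).

(** In a right evaluation the powers of the point stand to the right of the coefficients, so the
    quaternions are regarded as a right vector space over the slice. *)
Definition act (u q : quat) (c : C) : quat := qmul q (emb u c).

Lemma emb_add u c d : emb u (Cplus c d) = qadd (emb u c) (emb u d).
Proof. unfold emb; apply quat_ext; qunfold; simpl; ring. Qed.

Lemma emb_opp u c : emb u (Copp c) = qopp (emb u c).
Proof. unfold emb; apply quat_ext; qunfold; simpl; ring. Qed.

Lemma emb_mul u c d : im_unit u ->
  emb u (Cmult c d) = qmul (emb u c) (emb u d).
Proof.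
  intros Hu. unfold emb; apply quat_ext; qunfold; simpl; try ring.
  transitivity (fst c * fst d
    - snd c * snd d * (qi u * qi u + qj u * qj u + qk u * qk u)); [|ring].
  rewrite Hu. ring.
Qed.

Lemma emb_1 u : emb u (RtoC 1) = q1.
Proof. unfold emb; apply quat_ext; qunfold; simpl; ring. Qed.

Lemma emb_0 u : emb u (RtoC 0) = q0.
Proof. unfold emb; apply quat_ext; qunfold; simpl; ring. Qed.

Lemma emb_pow u c k : im_unit u -> emb u (Cpow c k) = qpow (emb u c) k.
Proof.
  intros Hu. induction k as [|k IH]; [apply emb_1|].
  rewrite Cpow_S, emb_mul, IH by assumption. simpl. apply qpow_comm.
Qed.

Lemma emb_csumn u n f : emb u (csumn n f) = qsumn n (fun k => emb u (f k)).
Proof.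
  induction n as [|n IH]; simpl; [apply emb_0|].
  now rewrite emb_add, IH.
Qed.

Lemma qnorm_emb u c : im_unit u -> qnorm (emb u c) = Cmod c.
Proof.
  intros Hu. unfold Cmod, qnorm, emb; cbn [qr qi qj qk]. f_equal.
  transitivity (fst c ^ 2
    + snd c ^ 2 * (qi u * qi u + qj u * qj u + qk u * qk u)); [ring|].
  rewrite Hu. ring.
Qed.

Lemma act_mul u q c d : im_unit u -> act u q (Cmult c d) = act u (act u q c) d.
Proof. intros Hu. unfold act. now rewrite emb_mul, qmulA. Qed.

Lemma act_addr u q c d : act u q (Cplus c d) = qadd (act u q c) (act u q d).
Proof. unfold act. rewrite emb_add. qring. Qed.

Lemma act_oppr u q c : act u q (Copp c) = qopp (act u q c).
Proof. unfold act. rewrite emb_opp. qring. Qed.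

Lemma act_addl u q p c : act u (qadd q p) c = qadd (act u q c) (act u p c).
Proof. unfold act. qring. Qed.

Lemma act_subl u q p c : act u (qsub q p) c = qsub (act u q c) (act u p c).
Proof. unfold act. qring. Qed.

Lemma act_csumn u n q f : act u q (csumn n f) = qsumn n (fun k => act u q (f k)).
Proof. unfold act. now rewrite emb_csumn, qsumn_mull. Qed.

Lemma act_qsumn u n c f : act u (qsumn n f) c = qsumn n (fun k => act u (f k) c).
Proof. unfold act. now rewrite qsumn_mulr. Qed.

Lemma qnorm_act u q c : im_unit u -> qnorm (act u q c) = qnorm q * Cmod c.
Proof. intros Hu. unfold act. now rewrite qnorm_mul, qnorm_emb. Qed.

(** Right multiplication by a slice element has right multiplication by its conjugate as adjoint.
    All complex factors thus collect on one side, where sums over roots of unity can be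
    evaluated. *)
Lemma qdot_act u a b c d : im_unit u ->
  qdot (act u a c) (act u b d) = qdot a (act u b (Cmult d (Cconj c))).
Proof.
  intros Hu. rewrite act_mul by assumption.
  unfold act, qdot, emb; qunfold; simpl. ring.
Qed.

(** * Roots of unity and Parseval's identity *)

Definition cis (t : R) : C := (cos t, sin t).

Lemma cis_add s t : cis (s + t) = Cmult (cis s) (cis t).
Proof.
  unfold cis, Cmult; simpl. rewrite cos_plus, sin_plus. f_equal; ring.
Qed.

Lemma cis_0 : cis 0 = RtoC 1.
Proof. unfold cis. now rewrite cos_0, sin_0. Qed.

Lemma cis_pow t n : Cpow (cis t) n = cis (INR n * t).
Proof.
  induction n as [|n IH]; [rewrite Rmult_0_l; symmetry; apply cis_0|].
  rewrite Cpow_S, IH, <- cis_add. f_equal. rewrite S_INR. ring.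
Qed.

Lemma Cmod_cis t : Cmod (cis t) = 1.
Proof.
  unfold Cmod, cis; cbn [fst snd].
  replace (cos t ^ 2 + sin t ^ 2) with 1; [apply sqrt_1|].
  pose proof (sin2_cos2 t) as H. unfold Rsqr in H. nra.
Qed.

Lemma cis_mul_conj t : Cmult (cis t) (Cconj (cis t)) = RtoC 1.
Proof.
  unfold cis, Cconj, Cmult, RtoC; simpl.
  pose proof (sin2_cos2 t) as H. unfold Rsqr in H. f_equal; lra.
Qed.

Lemma cis_neq_1 t : 0 < t < 2 * PI -> cis t <> RtoC 1.
Proof.
  intros Ht E. injection E as E _.
  replace t with (2 * (t / 2)) in E by field.
  rewrite cos_2a_sin in E.
  assert (0 < sin (t / 2)) by (apply sin_gt_0; lra). nra.
Qed.

(** The chord has length [2 sin (t/2)], which is at most the arc. *)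
Lemma Cmod_cis_sub_1 t : 0 <= t <= PI -> Cmod (Cminus (cis t) 1) <= t.
Proof.
  intros Ht. unfold Cmod, cis; simpl.
  assert (Hs : sin (t / 2) <= t / 2 /\ 0 <= sin (t / 2)).
  { split.
    - destruct (Req_dec t 0) as [->|]; [rewrite Rdiv_0_l, sin_0; lra|].
      left. apply sin_lt_x. lra.
    - apply sin_ge_0; lra. }
  pose proof (sin2_cos2 t) as H. unfold Rsqr in H.
  assert (E : cos t = 1 - 2 * sin (t / 2) * sin (t / 2)).
  { rewrite <- cos_2a_sin. f_equal. field. }
  apply Rle_trans with (sqrt (Rsqr t)).
  - apply sqrt_le_1_alt. unfold Rsqr. nra.
  - rewrite sqrt_Rsqr; lra.
Qed.

Definition zroot (N : nat) : C := cis (2 * PI / INR N).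

Lemma zroot_pow N k : Cpow (zroot N) k = cis (INR k * (2 * PI / INR N)).
Proof. apply cis_pow. Qed.

Lemma zroot_pow_N N : (0 < N)%nat -> Cpow (zroot N) N = RtoC 1.
Proof.
  intros HN. rewrite zroot_pow.
  assert (INR N <> 0) by (apply not_0_INR; lia).
  replace (INR N * (2 * PI / INR N)) with (2 * PI) by (field; assumption).
  unfold cis. now rewrite cos_2PI, sin_2PI.
Qed.

Lemma zroot_pow_neq_1 N d : (0 < d < N)%nat -> Cpow (zroot N) d <> RtoC 1.
Proof.
  intros Hd. rewrite zroot_pow. apply cis_neq_1.
  assert (HN : 0 < INR N) by (apply lt_0_INR; lia).
  assert (Hd0 : 0 < INR d) by (apply lt_0_INR; lia).
  assert (HdN : INR d < INR N) by (apply lt_INR; lia).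
  pose proof PI_RGT_0.
  replace (INR d * (2 * PI / INR N)) with (2 * PI * (INR d / INR N))
    by (field; lra).
  assert (0 < INR d / INR N) by (apply Rdiv_lt_0_compat; assumption).
  assert (INR d / INR N < 1).
  { apply (Rmult_lt_reg_r (INR N)); [assumption|]. unfold Rdiv.
    rewrite Rmult_assoc, Rinv_l by lra. lra. }
  nra.
Qed.

Lemma Cmod_zroot_pow N k : Cmod (Cpow (zroot N) k) = 1.
Proof. rewrite zroot_pow. apply Cmod_cis. Qed.

Lemma zroot_pow_mul_conj N k :
  Cmult (Cpow (zroot N) k) (Cconj (Cpow (zroot N) k)) = RtoC 1.
Proof. rewrite zroot_pow. apply cis_mul_conj. Qed.

Lemma csumn_pow_unity N v :
  Cpow v N = RtoC 1 -> v <> RtoC 1 -> csumn N (fun j => Cpow v j) = RtoC 0.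
Proof.
  intros H1 H2. pose proof (csumn_geometric N v) as G. rewrite H1 in G.
  replace (Cminus 1 1) with (RtoC 0) in G by ring.
  assert (Hv : Cminus v 1 <> RtoC 0).
  { intros E. apply H2. replace v with (Cplus (Cminus v 1) 1) by ring.
    rewrite E. ring. }
  replace (csumn N (fun j => Cpow v j))
    with (Cmult (Cinv (Cminus v 1))
            (Cmult (Cminus v 1) (csumn N (fun j => Cpow v j)))).
  - rewrite G. ring.
  - rewrite Cmult_assoc, Cinv_l by assumption. ring.
Qed.

(** With [w = zroot N], the summand is the [j]-th power of [w^l conj(w^m)], an [N]-th root of unity
    other than 1, so the geometric sum vanishes. *)
Lemma zroot_orthogonal N m l : (m < N)%nat -> (l < N)%nat -> m <> l ->
  csumn N (fun j => Cmult (Cpow (Cpow (zroot N) j) l)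
                          (Cconj (Cpow (Cpow (zroot N) j) m))) = RtoC 0.
Proof.
  intros Hm Hl Hne.
  set (w := zroot N).
  assert (E : forall j k, Cpow (Cpow w j) k = Cpow (Cpow w k) j).
  { intros j k. now rewrite <- !Cpow_mult_r, Nat.mul_comm. }
  transitivity
    (csumn N (fun j => Cpow (Cmult (Cpow w l) (Cconj (Cpow w m))) j)).
  { apply csumn_ext. intros j _.
    now rewrite Cpow_mult_l, <- Cpow_conj, !(E j). }
  apply csumn_pow_unity.
  - rewrite Cpow_mult_l, <- Cpow_conj, <- !(E N).
    unfold w. rewrite zroot_pow_N by lia. rewrite !Cpow_1_l.
    unfold Cconj, Cmult, RtoC; simpl. f_equal; ring.
  - intros H.
    assert (Hw : Cpow w l = Cpow w m).
    { pose proof (zroot_pow_mul_conj N m) as Hm1. fold w in Hm1.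
      transitivity (Cmult (Cmult (Cpow w l) (Cconj (Cpow w m))) (Cpow w m)).
      - transitivity (Cmult (Cpow w l) (Cmult (Cpow w m) (Cconj (Cpow w m)))).
        + rewrite Hm1. ring.
        + ring.
      - rewrite H. ring. }
    assert (A : forall a b, (a < b)%nat -> (b < N)%nat -> Cpow w a <> Cpow w b).
    { intros a b Hab Hb Heq. replace b with (a + (b - a))%nat in Heq by lia.
      rewrite Cpow_add_r in Heq.
      apply (zroot_pow_neq_1 N (b - a)); [lia|]. fold w.
      pose proof (zroot_pow_mul_conj N a) as Ha1. fold w in Ha1.
      transitivity (Cmult (Cmult (Cpow w a) (Cconj (Cpow w a))) (Cpow w (b - a))).
      - rewrite Ha1. ring.
      - transitivity (Cmult (Cconj (Cpow w a))
                       (Cmult (Cpow w a) (Cpow w (b - a)))); [ring|].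
        rewrite <- Heq, Cmult_comm. exact Ha1. }
    destruct (Nat.lt_total m l) as [Hlt|[Heq|Hlt]].
    + now apply (A m l).
    + contradiction.
    + now apply (A l m).
Qed.

Lemma qnrm2_qsumn n f :
  qnrm2 (qsumn n f) = rsumn n (fun m => rsumn n (fun l => qdot (f m) (f l))).
Proof.
  unfold qnrm2. rewrite qdot_qsumn_l. apply rsumn_ext. intros m _.
  apply qdot_qsumn_r.
Qed.

(** Expanding the squares leaves sums of [w^l conj(w^m)] over the [N]-th roots of unity, zero unless
    [l = m]. The condition [n <= N] keeps different exponents different modulo [N]. *)
Lemma parseval u N n c : im_unit u -> (n <= N)%nat ->
  rsumn N (fun j => qnrm2 (qsumn n (fun m => act u (c m) (Cpow (Cpow (zroot N) j) m))))
  = INR N * rsumn n (fun m => qnrm2 (c m)).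
Proof.
  intros Hu Hn.
  rewrite (rsumn_ext N _ (fun j => rsumn n (fun m => rsumn n (fun l =>
    qdot (c m) (act u (c l) (Cmult (Cpow (Cpow (zroot N) j) l)
                  (Cconj (Cpow (Cpow (zroot N) j) m)))))))).
  2:{ intros j _. rewrite qnrm2_qsumn. apply rsumn_ext. intros m _.
      apply rsumn_ext. intros l _. now apply qdot_act. }
  rewrite rsumn_exch, <- rsumn_scal. apply rsumn_ext. intros m Hm.
  rewrite rsumn_exch.
  rewrite (rsumn_ext n _ (fun l => qdot (c m) (act u (c l)
    (csumn N (fun j => Cmult (Cpow (Cpow (zroot N) j) l)
                  (Cconj (Cpow (Cpow (zroot N) j) m))))))).
  2:{ intros l _. rewrite act_csumn, qdot_qsumn_r. reflexivity. }
  rewrite (rsumn_delta n m).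
  - rewrite (csumn_ext N _ (fun _ => RtoC 1)).
    2:{ intros j _. rewrite <- Cpow_mult_r. apply zroot_pow_mul_conj. }
    rewrite csumn_1. unfold qnrm2, qdot, act, emb; qunfold; simpl. ring.
  - assumption.
  - intros l Hl Hne. rewrite zroot_orthogonal by lia.
    unfold act. rewrite emb_0. unfold qdot; qunfold; ring.
Qed.

(** Cauchy's estimate for a polynomial with [N] coefficients: by Parseval at [rho] times the [N]-th
    roots of unity, the squares of all [|c_m| rho^m] add up to at most [S^2]. *)
Lemma coefficient_le u N (c : nat -> quat) rho S k :
  im_unit u -> (k < N)%nat -> 0 <= rho -> 0 <= S ->
  (forall z, Cmod z = rho ->
     qnorm (qsumn N (fun m => act u (c m) (Cpow z m))) <= S) ->
  qnorm (c k) * rho ^ k <= S.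
Proof.
  intros Hu Hk Hrho HS H.
  assert (HN : 0 < INR N) by (apply lt_0_INR; lia).
  pose proof (parseval u N N (fun m => act u (c m) (RtoC (rho ^ m))) Hu
    (Nat.le_refl N)) as P.
  cbv beta in P.
  assert (L : rsumn N (fun m => qnrm2 (act u (c m) (RtoC (rho ^ m)))) <= S * S).
  { apply (Rmult_le_reg_l (INR N)); [assumption|]. rewrite <- P.
    rewrite <- rsumn_const. apply rsumn_le. intros j _.
    rewrite <- qnorm_sqr.
    rewrite (qsumn_ext N _
      (fun m => act u (c m) (Cpow (Cmult (RtoC rho) (Cpow (zroot N) j)) m))).
    2:{ intros m _. rewrite <- act_mul, Cpow_mult_l, RtoC_pow by assumption.
        reflexivity. }
    assert (B := H (Cmult (RtoC rho) (Cpow (zroot N) j))).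
    apply Rmult_le_compat; try apply qnorm_ge0; apply B;
    now rewrite Cmod_mult, Cmod_zroot_pow, Cmod_R, Rabs_pos_eq, Rmult_1_r. }
  assert (T : qnrm2 (act u (c k) (RtoC (rho ^ k))) <= S * S).
  { eapply Rle_trans; [|apply L].
    eapply Rle_trans; [|apply (rsumn_incr (1 + k))].
    - simpl.
      assert (0 <= rsumn k (fun m => qnrm2 (act u (c m) (RtoC (rho ^ m))))).
      { apply rsumn_ge0. intros; apply qnrm2_ge0. }
      lra.
    - intros; apply qnrm2_ge0.
    - lia. }
  apply qnorm_le in T; [|assumption].
  rewrite qnorm_act, Cmod_R, Rabs_pos_eq in T; try assumption.
  now apply pow_le.
Qed.

(** * A discrete Cauchy formula *)

(* The left-hand side is [(a-b)(b-c)(c-a)] times minus the second divided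
   difference of [h]. *)
Definition three_point (u : quat) (r K : R) (h : C -> quat) : Prop :=
  forall a b c, Cmod a <= r -> Cmod b <= r -> Cmod c <= r ->
    qnorm (qadd (qadd (act u (h a) (Cminus b c)) (act u (h b) (Cminus c a)))
                (act u (h c) (Cminus a b)))
    <= K * (Cmod (Cminus a b) * Cmod (Cminus b c) * Cmod (Cminus c a)).

(** With [w] the [j]-th power of [zroot N], this is the truncated expansion of the Cauchy kernel
    [w / (w - z)] in powers of [z / w]; the conjugate of [w] is its inverse. *)
Definition cauchy_weight (N : nat) (z : C) (j : nat) : C :=
  csumn N (fun k => Cpow (Cmult z (Cconj (Cpow (zroot N) j))) k).

(** A geometric sum in which [w^N = 1] turns the last power into [z^N]. Truncation therefore costs
    the factor [1 - z^N], the same for every [j]; this independence of [j] makes the telescoping in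
    [cauchy_sum_step] possible. *)
Lemma cauchy_weight_mul N z j : (0 < N)%nat ->
  Cmult (cauchy_weight N z j) (Cminus (Cpow (zroot N) j) z) =
  Cmult (Cpow (zroot N) j) (Cminus 1 (Cpow z N)).
Proof.
  intros HN. unfold cauchy_weight.
  pose proof (csumn_geometric N (Cmult z (Cconj (Cpow (zroot N) j)))) as G.
  set (W := csumn N _) in *.
  assert (Ev : Cpow (Cmult z (Cconj (Cpow (zroot N) j))) N = Cpow z N).
  { rewrite Cpow_mult_l, <- Cpow_conj, <- Cpow_mult_r, Nat.mul_comm,
      Cpow_mult_r, zroot_pow_N, Cpow_1_l by assumption.
    unfold Cconj, Cmult, RtoC; simpl. destruct (Cpow z N); simpl.
    f_equal; ring. }
  rewrite Ev in G. pose proof (zroot_pow_mul_conj N j) as H1.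
  set (w := Cpow (zroot N) j) in *. clearbody W w. clear Ev.
  transitivity (Copp (Cmult w (Cmult (Cminus (Cmult z (Cconj w)) 1) W))).
  - transitivity (Cmult (Cminus w (Cmult z (Cmult w (Cconj w)))) W).
    + rewrite H1. ring.
    + ring.
  - rewrite G. ring.
Qed.

(** After exchanging the sums, orthogonality leaves only the power [k = 0]. *)
Lemma cauchy_weight_sum N z : (0 < N)%nat ->
  csumn N (cauchy_weight N z) = RtoC (INR N).
Proof.
  intros HN. unfold cauchy_weight. rewrite csumn_exch.
  rewrite (csumn_ext N _ (fun k => Cmult (Cpow z k)
    (csumn N (fun j => Cmult (Cpow (Cpow (zroot N) j) O)
                (Cconj (Cpow (Cpow (zroot N) j) k)))))).
  2:{ intros k _. rewrite <- csumn_mull. apply csumn_ext. intros j _.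
      rewrite Cpow_mult_l, <- Cpow_conj.
      change (Cpow (Cpow (zroot N) j) 0) with (RtoC 1). ring. }
  rewrite (csumn_delta N O); [|assumption|].
  - rewrite (csumn_ext N _ (fun _ => RtoC 1)), csumn_1; [simpl; ring|].
    intros j _. unfold Cconj, Cmult, RtoC; simpl. f_equal; ring.
  - intros k Hk Hne. rewrite zroot_orthogonal by lia. ring.
Qed.

Definition cauchy_point (N : nat) (z : C) (t : R) (j : nat) : C :=
  Cplus z (Cmult (RtoC t) (Cminus (Cpow (zroot N) j) z)).

Lemma Cmod_cauchy_point N z t j : Cmod z <= 1 -> 0 <= t <= 1 ->
  Cmod (cauchy_point N z t j) <= 1.
Proof.
  intros Hz Ht. unfold cauchy_point.
  replace (Cplus z (Cmult t (Cminus (Cpow (zroot N) j) z)))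
    with (Cplus (Cmult (RtoC (1 - t)) z) (Cmult t (Cpow (zroot N) j))).
  2:{ rewrite RtoC_minus. ring. }
  eapply Rle_trans; [apply Cmod_triangle|].
  rewrite !Cmod_mult, !Cmod_R, Cmod_zroot_pow, !Rabs_pos_eq by lra. nra.
Qed.

(* [N] times the mean of [h] over the unit circle shrunk by the factor [t] towards
   [z], against the Cauchy kernel of the unit circle, truncated after [N] terms; the
   discrete Cauchy theorem says that it is almost independent of [t]. *)
Definition cauchy_sum (u : quat) (h : C -> quat) (N : nat) (z : C) (t : R) : quat :=
  qsumn N (fun j => act u (h (cauchy_point N z t j)) (cauchy_weight N z j)).

Lemma Cmod_sub_le a b : Cmod (Cminus a b) <= Cmod a + Cmod b.
Proof. unfold Cminus. rewrite <- (Cmod_opp b). apply Cmod_triangle. Qed.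

(** One contraction of the contour. For each [j] the three-point bound is applied to the triangle of
    the new point [a], the next old point [b] and the current old point [c]. Differences across the
    two contours add up to the change of [cauchy_sum]; differences along the old contour telescope
    around it. *)
Lemma cauchy_sum_step u K h N z t d :
  im_unit u -> 0 <= K -> three_point u 1 K h -> (2 <= N)%nat -> Cmod z < 1 ->
  0 < t <= 1 -> 0 < d <= t ->
  qnorm (qsub (cauchy_sum u h N z (t - d)) (cauchy_sum u h N z t))
  <= INR N * (2 * K * d * (Cmod (Cminus (zroot N) 1) + 2 * d)).
Proof.
  intros Hu HK H3 HN Hz Ht Hd.
  set (om := zroot N).
  set (w := fun j => Cpow om j).
  set (W := cauchy_weight N z).
  set (A := fun j => h (cauchy_point N z (t - d) j)).
  set (B := fun j => h (cauchy_point N z t j)).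
  set (e := Cmod (Cminus om 1)).
  assert (He : 0 < e).
  { apply Cmod_gt_0. intros E. apply (zroot_pow_neq_1 N 1); [lia|].
    rewrite Cpow_1_r. fold om.
    replace om with (Cplus (Cminus om 1) 1) by ring. rewrite E. ring. }
  (* This is the three-point expression times [(1 - z^N) / (w_j - z)], with the quotient absorbed
     into the weight [W j]. *)
  set (G := fun j => qadd
    (act u (qsub (A j) (B j)) (Cmult (W j) (Cmult (RtoC t) (Cminus om 1))))
    (act u (qsub (B (S j)) (B j)) (Cmult (RtoC d) (Cminus 1 (Cpow z N))))).
  assert (HG : forall j, qnorm (G j) <= 2 * K * d * t * e * (e + 2 * d)).
  { intros j.
    set (a := cauchy_point N z (t - d) j).
    set (b := cauchy_point N z t (S j)).
    set (c := cauchy_point N z t j).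
    assert (Ebc : Cminus b c = Cmult (RtoC t) (Cmult (w j) (Cminus om 1))).
    { unfold b, c, cauchy_point, w. fold om. rewrite Cpow_S. ring. }
    assert (Eca : Cminus c a = Cmult (RtoC d) (Cminus (w j) z)).
    { unfold c, a, cauchy_point, w. fold om. rewrite RtoC_minus. ring. }
    assert (Hw : Cmod (w j) = 1) by apply Cmod_zroot_pow.
    assert (Hwz : 0 < Cmod (Cminus (w j) z)).
    { apply Cmod_gt_0. intros E.
      replace z with (w j) in Hz; [lra|].
      replace (w j) with (Cplus (Cminus (w j) z) z) by ring. rewrite E. ring. }
    assert (T := H3 a b c).
    specialize (T (Cmod_cauchy_point N z (t - d) j (Rlt_le _ _ Hz) ltac:(lra))).
    specialize (T (Cmod_cauchy_point N z t (S j) (Rlt_le _ _ Hz) ltac:(lra))).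
    specialize (T (Cmod_cauchy_point N z t j (Rlt_le _ _ Hz) ltac:(lra))).
    fold (A j) in T.
    set (T0 := qadd _ _) in T.
    (* Since [a - b = -(b - c) - (c - a)], [T0] involves only the differences [h a - h c] and
       [h b - h c]; [cauchy_weight_mul] matches the factors. *)
    assert (EG : act u (G j) (Cminus (w j) z) = act u T0 (Cminus 1 (Cpow z N))).
    { unfold G, T0. fold (B (S j)). fold (B j).
      change (h a) with (A j). change (h b) with (B (S j)). change (h c) with (B j).
      rewrite !act_addl, !act_subl, <- !act_mul by assumption.
      pose proof (cauchy_weight_mul N z j ltac:(lia)) as EW.
      fold om in EW. fold (w j) in EW. fold W in EW.
      replace (Cmult (Cmult (W j) (Cmult t (Cminus om 1))) (Cminus (w j) z))
        with (Cmult (Cminus b c) (Cminus 1 (Cpow z N))).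
      2:{ rewrite Ebc.
          transitivity (Cmult (Cmult (W j) (Cminus (w j) z))
                          (Cmult t (Cminus om 1))); [rewrite EW|]; ring. }
      replace (Cmult (Cmult d (Cminus 1 (Cpow z N))) (Cminus (w j) z))
        with (Cmult (Cminus c a) (Cminus 1 (Cpow z N))).
      2:{ rewrite Eca. ring. }
      replace (Cmult (Cminus a b) (Cminus 1 (Cpow z N)))
        with (Copp (Cplus (Cmult (Cminus b c) (Cminus 1 (Cpow z N)))
                          (Cmult (Cminus c a) (Cminus 1 (Cpow z N))))) by ring.
      rewrite act_oppr, act_addr. qring. }
    assert (EN : qnorm (G j) * Cmod (Cminus (w j) z)
                 = qnorm T0 * Cmod (Cminus 1 (Cpow z N))).
    { now rewrite <- !(qnorm_act u), EG. }
    assert (HzN : Cmod (Cminus 1 (Cpow z N)) <= 2).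
    { eapply Rle_trans; [apply Cmod_sub_le|]. rewrite Cmod_1, Cmod_pow.
      assert (Cmod z ^ N <= 1).
      { apply pow_le_1. split; [apply Cmod_ge_0|lra]. }
      lra. }
    assert (Hab : Cmod (Cminus a b) <= e + 2 * d).
    { replace (Cminus a b)
        with (Cminus (Copp (Cminus b c)) (Cminus c a)) by ring.
      eapply Rle_trans; [apply Cmod_sub_le|].
      rewrite Cmod_opp, Ebc, Eca, !Cmod_mult, Hw, !Cmod_R, !Rabs_pos_eq by lra.
      assert (Cmod (Cminus (w j) z) <= 2).
      { eapply Rle_trans; [apply Cmod_sub_le|]. lra. }
      fold e. nra. }
    rewrite Ebc, Eca, !Cmod_mult, Hw, !Cmod_R, !Rabs_pos_eq in T by lra.
    fold e in T.
    apply (Rmult_le_reg_r (Cmod (Cminus (w j) z))); [assumption|].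
    rewrite EN.
    set (x := Cmod (Cminus (w j) z)) in *.
    set (y := Cmod (Cminus a b)) in *.
    assert (Hy : 0 <= y) by apply Cmod_ge_0.
    apply Rle_trans with (qnorm T0 * 2).
    { apply Rmult_le_compat_l; [apply qnorm_ge0|assumption]. }
    apply Rle_trans with (K * (y * (t * (1 * e)) * (d * x)) * 2); [lra|].
    replace (2 * K * d * t * e * (e + 2 * d) * x)
      with (2 * (K * (t * (e * (d * x)))) * (e + 2 * d)) by ring.
    replace (K * (y * (t * (1 * e)) * (d * x)) * 2)
      with (2 * (K * (t * (e * (d * x)))) * y) by ring.
    apply Rmult_le_compat_l; [|assumption].
    apply Rmult_le_pos; [lra|]. repeat apply Rmult_le_pos; lra. }
  assert (ES : qsumn N G = act u
    (qsub (cauchy_sum u h N z (t - d)) (cauchy_sum u h N z t))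
    (Cmult (RtoC t) (Cminus om 1))).
  { unfold G. rewrite qsumn_add, <- act_qsumn.
    (* The contour closes up: the root with index [N] is the root with index 0. *)
    replace (qsumn N (fun k => qsub (B (S k)) (B k))) with q0.
    2:{ rewrite qsumn_telescope.
        replace (B N) with (B O); [qring|].
        unfold B, cauchy_point. rewrite zroot_pow_N by lia. reflexivity. }
    replace (act u q0 (Cmult d (Cminus 1 (Cpow z N)))) with q0
      by (unfold act; qring).
    rewrite (qsumn_ext N _ (fun j => qsub
       (act u (act u (A j) (W j)) (Cmult t (Cminus om 1)))
       (act u (act u (B j) (W j)) (Cmult t (Cminus om 1))))).
    2:{ intros j _. now rewrite act_subl, !(act_mul u _ (W j)). }
    rewrite qsumn_sub, <- !act_qsumn, <- act_subl.
    unfold cauchy_sum, A, B, W. qring. }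
  assert (EN : qnorm (qsub (cauchy_sum u h N z (t - d)) (cauchy_sum u h N z t))
               * (t * e) <= INR N * (2 * K * d * t * e * (e + 2 * d))).
  { replace (t * e) with (Cmod (Cmult (RtoC t) (Cminus om 1))).
    2:{ rewrite Cmod_mult, Cmod_R, Rabs_pos_eq by lra. reflexivity. }
    rewrite <- (qnorm_act u), <- ES by assumption.
    apply qsumn_norm_le_const. intros; apply HG. }
  apply (Rmult_le_reg_r (t * e)); [apply Rmult_lt_0_compat; lra|].
  eapply Rle_trans; [apply EN|]. right. ring.
Qed.

(** The [k]-th discrete Fourier coefficient of [h] on the [N]-th roots of unity. *)
Definition interp_coef (u : quat) (h : C -> quat) (N k : nat) : quat :=
  act u (qsumn N (fun j => act u (h (Cpow (zroot N) j))
                             (Cconj (Cpow (Cpow (zroot N) j) k))))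
    (RtoC (/ INR N)).

Lemma interp_coef_le u h N k : im_unit u -> (0 < N)%nat ->
  (forall z, Cmod z <= 1 -> qnorm (h z) <= 1) -> qnorm (interp_coef u h N k) <= 1.
Proof.
  intros Hu HN Hh. assert (H : 0 < INR N) by (apply lt_0_INR; lia).
  unfold interp_coef. rewrite qnorm_act, Cmod_R, Rabs_pos_eq by
    (try assumption; left; apply Rinv_0_lt_compat; assumption).
  apply (Rmult_le_reg_r (INR N)); [assumption|].
  rewrite Rmult_assoc, Rinv_l, Rmult_1_r, Rmult_1_l by lra.
  rewrite <- (Rmult_1_r (INR N)). apply qsumn_norm_le_const.
  intros j _. rewrite qnorm_act, Cmod_conj, <- Cpow_mult_r, Cmod_zroot_pow by assumption.
  rewrite Rmult_1_r. apply Hh. rewrite Cmod_zroot_pow. lra.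
Qed.

(** At [t = 1] the Cauchy sum is [N] times the interpolating polynomial at [z], at [t = 0] it is
    [N h(z)]. The two are joined by [N] steps of length [1/N], each costing at most [b], so [b]
    bounds the error after division by [N]. From [|zroot N - 1| <= 2 PI / N <= 8 / N] comes
    [b <= 2 K (8 + 2) / N]. *)
Lemma interpolation_error u K h N z :
  im_unit u -> 0 <= K -> three_point u 1 K h -> (2 <= N)%nat -> Cmod z < 1 ->
  qnorm (qsub (qsumn N (fun k => act u (interp_coef u h N k) (Cpow z k))) (h z))
  <= 20 * K / INR N.
Proof.
  intros Hu HK H3 HN Hz.
  assert (HN0 : 0 < INR N) by (apply lt_0_INR; lia).
  set (b := INR N * (2 * K * (1 / INR N) * (Cmod (Cminus (zroot N) 1) + 2 * (1 / INR N)))).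
  assert (Hstep : forall i, (i <= N)%nat ->
    qnorm (qsub (cauchy_sum u h N z 0) (cauchy_sum u h N z (INR i / INR N)))
    <= INR i * b).
  { induction i as [|i IH]; intros Hi.
    - simpl INR. rewrite Rdiv_0_l, Rmult_0_l.
      replace (qsub _ _) with q0 by qring. rewrite qnorm0; lra.
    - specialize (IH ltac:(lia)).
      eapply Rle_trans; [apply (qnorm_triangle _ (cauchy_sum u h N z (INR i / INR N)))|].
      assert (Hi1 : INR (S i) <= INR N) by (apply le_INR; lia).
      pose proof (pos_INR i) as Hi0.
      rewrite S_INR in *.
      assert (Hd : 0 < 1 / INR N) by (apply Rdiv_lt_0_compat; lra).
      assert (Es : INR i / INR N = (INR i + 1) / INR N - 1 / INR N) by (field; lra).
      assert (Hi2 : 0 <= INR i / INR N) by (apply Rdiv_le_0_compat; lra).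
      assert (Hi3 : (INR i + 1) / INR N <= 1).
      { apply (Rmult_le_reg_r (INR N)); [assumption|]. unfold Rdiv.
        rewrite Rmult_assoc, Rinv_l by lra. lra. }
      rewrite Rmult_plus_distr_r. apply Rplus_le_compat; [exact IH|].
      rewrite Rmult_1_l, Es. apply cauchy_sum_step; try assumption; lra. }
  specialize (Hstep N (Nat.le_refl N)).
  replace (INR N / INR N) with 1 in Hstep by (field; lra).
  assert (E0 : cauchy_sum u h N z 0 = act u (h z) (RtoC (INR N))).
  { unfold cauchy_sum. rewrite <- (cauchy_weight_sum N z), act_csumn by lia.
    apply qsumn_ext. intros j _. f_equal. f_equal. unfold cauchy_point. ring. }
  assert (E1 : cauchy_sum u h N z 1
    = act u (qsumn N (fun k => act u (interp_coef u h N k) (Cpow z k))) (RtoC (INR N))).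
  { unfold cauchy_sum, cauchy_weight.
    rewrite (qsumn_ext N _ (fun j => qsumn N (fun k =>
       act u (h (Cpow (zroot N) j))
         (Cpow (Cmult z (Cconj (Cpow (zroot N) j))) k)))).
    2:{ intros j _. rewrite act_csumn. apply qsumn_ext. intros k _.
        f_equal. f_equal. unfold cauchy_point. ring. }
    rewrite qsumn_exch, act_qsumn. apply qsumn_ext. intros k _.
    unfold interp_coef. rewrite <- !act_mul, act_qsumn by assumption.
    apply qsumn_ext. intros j _. rewrite <- act_mul by assumption. f_equal.
    rewrite Cpow_mult_l, <- Cpow_conj.
    assert (Ei : Cmult (RtoC (/ INR N)) (RtoC (INR N)) = RtoC 1).
    { rewrite <- RtoC_mult. f_equal. field. lra. }
    transitivity (Cmult (Cmult (Cpow z k) (Cconj (Cpow (Cpow (zroot N) j) k)))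
       (Cmult (RtoC (/ INR N)) (RtoC (INR N)))); [rewrite Ei|]; ring. }
  rewrite qnorm_sub_sym, E0, E1, <- act_subl, qnorm_act, Cmod_R, Rabs_pos_eq
    in Hstep by (try assumption; lra).
  assert (Hb : b <= 20 * K / INR N).
  { unfold b.
    assert (Hcis : Cmod (Cminus (zroot N) 1) <= 2 * PI / INR N).
    { pose proof PI_RGT_0. apply Cmod_cis_sub_1. split.
      - apply Rdiv_le_0_compat; lra.
      - assert (2 <= INR N) by (apply (le_INR 2); lia).
        apply (Rmult_le_reg_r (INR N)); [assumption|].
        unfold Rdiv. rewrite Rmult_assoc, Rinv_l by lra. nra. }
    pose proof PI_4.
    apply Rle_trans with (2 * K * (8 / INR N + 2 / INR N)).
    - replace (INR N * (2 * K * (1 / INR N) * (Cmod (Cminus (zroot N) 1) + 2 * (1 / INR N))))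
        with (2 * K * (Cmod (Cminus (zroot N) 1) + 2 / INR N)) by (field; lra).
      apply Rmult_le_compat_l; [lra|]. apply Rplus_le_compat_r.
      eapply Rle_trans; [apply Hcis|]. apply Rmult_le_compat_r; [|lra].
      left. apply Rinv_0_lt_compat. assumption.
    - right. field. lra. }
  eapply Rle_trans; [|apply Hb].
  apply (Rmult_le_reg_r (INR N)); [assumption|]. lra.
Qed.

(** Two interpolating polynomials are both close to [h] on [|z| = 1/2], so Cauchy's estimate makes
    each coefficient a Cauchy sequence in [N]. All coefficients are bounded by 1, which gives a tail
    bound uniform in [N] and permits the limit under the sum. The radius 1/2 is only a convenient
    one below 1. *)
Lemma power_series_expansion u K h :
  im_unit u -> 0 <= K -> three_point u 1 K h ->
  (forall z, Cmod z <= 1 -> qnorm (h z) <= 1) ->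
  exists m : nat -> quat,
    (forall k, qnorm (m k) <= 1) /\
    (forall z, Cmod z < 1 -> qlim (fun n => qsumn n (fun k => act u (m k) (Cpow z k))) (h z)).
Proof.
  intros Hu HK H3 Hh.
  set (M := interp_coef u h).
  assert (Hsmall : forall B eps, 0 <= B -> 0 < eps ->
    exists N0, forall N, (N0 <= N)%nat -> (2 <= N)%nat /\ B / INR N < eps).
  { intros B eps HB He. destruct (INR_unbounded (B / eps)) as [N0 HN0].
    exists (N0 + 2)%nat. intros N HN. split; [lia|].
    assert (HN1 : INR N0 <= INR N) by (apply le_INR; lia).
    assert (HN2 : 0 < INR N) by (apply lt_0_INR; lia).
    apply (Rmult_lt_reg_r (INR N)); [assumption|]. unfold Rdiv.
    rewrite Rmult_assoc, Rinv_l, Rmult_1_r by lra.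
    apply (Rmult_lt_reg_r (/ eps)); [apply Rinv_0_lt_compat; lra|].
    unfold Rdiv in HN0. replace (eps * INR N * / eps) with (INR N) by (field; lra).
    lra. }
  assert (Hlim : forall k, { s | qlim (fun N => M N k) s }).
  { intros k. apply qlim_cauchy. intros eps He.
    assert (Hp : 0 < (1 / 2) ^ k) by (apply pow_lt; lra).
    destruct (Hsmall (20 * K) (eps * (1 / 2) ^ k / 4)) as [N0 HN0]; [lra| |].
    { apply Rdiv_lt_0_compat; [apply Rmult_lt_0_compat; assumption|lra]. }
    exists (N0 + S k)%nat.
    intros n m Hn Hm.
    destruct (HN0 n) as [Hn2 Hne]; [lia|]. destruct (HN0 m) as [Hm2 Hme]; [lia|].
    (* Polynomials with [n] and [m] coefficients are padded with zeros to the common length [n + m],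
       so that their difference is a single sum. *)
    set (c := fun N j => if Nat.ltb j N then M N j else q0).
    assert (Epad : forall N z, (N <= n + m)%nat ->
      qsumn (n + m) (fun j => act u (c N j) (Cpow z j))
      = qsumn N (fun j => act u (M N j) (Cpow z j))).
    { intros N z HN. replace (n + m)%nat with (N + (n + m - N))%nat by lia.
      rewrite qsumn_split.
      rewrite (qsumn_ext N _ (fun j => act u (M N j) (Cpow z j))).
      2:{ intros j Hj. unfold c. now rewrite (proj2 (Nat.ltb_lt j N)). }
      rewrite (qsumn_ext (n + m - N) _ (fun _ => q0)), qsumn_0; [qring|].
      intros j _. unfold c. rewrite (proj2 (Nat.ltb_ge (N + j) N)) by lia.
      unfold act. qring. }
    assert (Hc := coefficient_le u (n + m) (fun j => qsub (c n j) (c m j))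
      (1 / 2) (eps * (1 / 2) ^ k / 2) k Hu ltac:(lia) ltac:(lra)).
    cbv beta in Hc. unfold c in Hc at 3 4.
    rewrite !(fun N => proj2 (Nat.ltb_lt k N)) in Hc by lia.
    apply Rle_lt_trans with (eps / 2); [|lra].
    apply (Rmult_le_reg_r ((1 / 2) ^ k)); [assumption|].
    replace (eps / 2 * (1 / 2) ^ k) with (eps * (1 / 2) ^ k / 2) by field.
    apply Hc.
    { assert (0 < eps * (1 / 2) ^ k) by (apply Rmult_lt_0_compat; assumption). lra. }
    intros z Hz.
    rewrite (qsumn_ext (n + m) _ (fun j => qsub (act u (c n j) (Cpow z j))
      (act u (c m j) (Cpow z j)))) by (intros; apply act_subl).
    rewrite qsumn_sub, !Epad by lia.
    eapply Rle_trans; [apply (qnorm_triangle _ (h z))|].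
    rewrite (qnorm_sub_sym (h z)).
    pose proof (interpolation_error u K h n z Hu HK H3 Hn2 ltac:(lra)).
    pose proof (interpolation_error u K h m z Hu HK H3 Hm2 ltac:(lra)).
    unfold M. lra. }
  set (m := fun k => proj1_sig (Hlim k)).
  assert (Hm : forall k, qlim (fun N => M N k) (m k))
    by (intros k; exact (proj2_sig (Hlim k))).
  exists m. split.
  { intros k. replace (m k) with (qsub (m k) q0) by qring.
    apply (qlim_norm_sub_le (fun N => M N k) _ _ _ 1%nat (Hm k)).
    intros N HN. replace (qsub (M N k) q0) with (M N k) by qring.
    now apply interp_coef_le. }
  intros z Hz.
  pose proof (Cmod_ge_0 z) as Hz0.
  (* With [n] fixed, the [n]-term sums of the interpolating polynomials are compared with [h z], and
     [N] then tends to infinity. *)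
  assert (Htail : forall n,
    qnorm (qsub (qsumn n (fun k => act u (m k) (Cpow z k))) (h z))
    <= 1 * Cmod z ^ n / (1 - Cmod z)).
  { intros n. apply le_epsilon. intros eps He.
    destruct (Hsmall (20 * K) eps) as [N0 HN0]; [lra|assumption|].
    apply (qlim_norm_sub_le
      (fun N => qsumn n (fun k => act u (M N k) (Cpow z k))) _ _ _ (N0 + n)).
    { apply (qlim_qsumn n (fun k N => act u (M N k) (Cpow z k))
        (fun k => act u (m k) (Cpow z k))).
      intros k _. pose proof (qlim_mul q1 (emb u (Cpow z k)) _ _ (Hm k)) as Q.
      rewrite qmul1l in Q. eapply qlim_ext; [|apply Q].
      intros N. simpl. rewrite qmul1l. reflexivity. }
    intros N HN. destruct (HN0 N) as [HN2 HNe]; [lia|].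
    eapply Rle_trans;
      [apply (qnorm_triangle _ (qsumn N (fun k => act u (M N k) (Cpow z k))))|].
    apply Rplus_le_compat.
    - rewrite qnorm_sub_sym. apply qsumn_geometric_tail; [lra| |lia].
      intros k. rewrite qnorm_act, Cmod_pow by assumption.
      apply Rmult_le_compat_r; [now apply pow_le|].
      apply interp_coef_le; [assumption|lia|assumption].
    - eapply Rle_trans; [|left; apply HNe].
      now apply interpolation_error. }
  intros eps He.
  destruct (pow_small (Cmod z) (/ (1 - Cmod z)) eps) as [N HN]; [lra| |assumption|].
  { left. apply Rinv_0_lt_compat. lra. }
  exists N. intros n Hn. eapply Rle_lt_trans; [apply Htail|].
  replace (1 * Cmod z ^ n / (1 - Cmod z)) with (/ (1 - Cmod z) * Cmod z ^ n)
    by (field; lra).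
  now apply HN.
Qed.

(** * Consequences of the Pick condition *)

Lemma qsumn_gram n a :
  qsumn n (fun i => qsumn n (fun j => qmul (qconj (a i)) (a j)))
  = qmul (qconj (qsumn n a)) (qsumn n a).
Proof.
  rewrite (qsumn_ext n _ (fun i => qmul (qconj (a i)) (qsumn n a)))
    by (intros; apply qsumn_mull).
  now rewrite qsumn_mulr, qsumn_conj.
Qed.

Lemma qr_conj_mul a : qr (qmul (qconj a) a) = qnrm2 a.
Proof. unfold qnrm2, qdot; qunfold; ring. Qed.

(** The Pick series is known to converge only as a whole, not its two halves. The contraction
    inequality is therefore stated for partial sums, up to [eps]. *)
Lemma pick_inequality n f z P x :
  (forall i j, (i < n)%nat -> (j < n)%nat -> qseries (dual_pick_term f z i j) (P i j)) ->
  qpsd n P ->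
  forall eps, 0 < eps -> exists N, forall m, (N <= m)%nat ->
    rsumn m (fun k => qnrm2 (qsumn n (fun i => qmul (f (z i)) (qmul (qpow (z i) k) (x i)))))
    <= rsumn m (fun k => qnrm2 (qsumn n (fun i => qmul (qpow (z i) k) (x i)))) + eps.
Proof.
  intros HS [_ HP] eps He.
  destruct (HP x) as (_ & _ & _ & Hv).
  set (V := fun m => qsumn n (fun i => qsumn n (fun j =>
    qmul (qmul (qconj (x i)) (qsumn m (dual_pick_term f z i j))) (x j)))).
  assert (HV : qlim V (qsumn n (fun i => qsumn n (fun j =>
    qmul (qmul (qconj (x i)) (P i j)) (x j))))).
  { apply (qlim_qsumn n (fun i m => qsumn n (fun j =>
      qmul (qmul (qconj (x i)) (qsumn m (dual_pick_term f z i j))) (x j)))).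
    intros i Hi.
    apply (qlim_qsumn n (fun j m =>
      qmul (qmul (qconj (x i)) (qsumn m (dual_pick_term f z i j))) (x j))).
    intros j Hj. apply qlim_mul. apply qseries_qlim. now apply HS. }
  destruct (HV eps He) as [N HN]. exists N. intros m Hm. specialize (HN m Hm).
  assert (HV0 : - eps < qr (V m)).
  { set (v := qsumn n _) in HN, Hv.
    pose proof (Rle_lt_trans _ _ _ (qr_le_qnorm (qsub (V m) v)) HN) as H.
    apply Rabs_def2 in H. destruct H as [_ H].
    change (qr (qsub (V m) v)) with (qr (V m) - qr v) in H.
    cbv zeta in Hv. lra. }
  assert (EV : V m = qsumn m (fun k => qsub
    (qmul (qconj (qsumn n (fun i => qmul (qpow (z i) k) (x i))))
          (qsumn n (fun i => qmul (qpow (z i) k) (x i))))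
    (qmul (qconj (qsumn n (fun i => qmul (f (z i)) (qmul (qpow (z i) k) (x i)))))
          (qsumn n (fun i => qmul (f (z i)) (qmul (qpow (z i) k) (x i))))))).
  { unfold V.
    rewrite (qsumn_ext n _ (fun i => qsumn m (fun k => qsumn n (fun j =>
      qmul (qmul (qconj (x i)) (dual_pick_term f z i j k)) (x j))))).
    2:{ intros i _. rewrite qsumn_exch. apply qsumn_ext. intros j _.
        now rewrite <- qsumn_mull, <- qsumn_mulr. }
    rewrite qsumn_exch. apply qsumn_ext. intros k _.
    rewrite <- !qsumn_gram, <- qsumn_sub. apply qsumn_ext. intros i _.
    rewrite <- qsumn_sub. apply qsumn_ext. intros j _.
    unfold dual_pick_term. rewrite qpow_conj, !qconj_mul, !qmulA.
    now rewrite qmul_subl, !qmul_subr, qmul1l, !qmulA. }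
  rewrite EV, qr_qsumn in HV0.
  rewrite (rsumn_ext m _ (fun k =>
     qnrm2 (qsumn n (fun i => qmul (qpow (z i) k) (x i)))
     + -1 * qnrm2 (qsumn n (fun i => qmul (f (z i)) (qmul (qpow (z i) k) (x i)))))) in HV0.
  2:{ intros k _. rewrite <- !qr_conj_mul. unfold qsub, qadd, qopp; cbn [qr]. ring. }
  rewrite rsumn_add, rsumn_scal in HV0. lra.
Qed.

Lemma pick_bounded f :
  (forall z1 z2 z3 : quat, in_ball z1 -> in_ball z2 -> in_ball z3 ->
     dual_pick3_psd f z1 z2 z3) ->
  forall a, in_ball a -> qnorm (f a) <= 1.
Proof.
  intros hP a Ha. destruct (hP a a a Ha Ha Ha) as [P [HS HP]].
  apply qnorm_le; [lra|]. apply le_epsilon. intros eps He.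
  (* The weights [(1, 0, 0)] reduce the matrix to its diagonal entry at [a]. *)
  destruct (pick_inequality 3 f _ P (pts3 q1 q0 q0) HS HP eps He) as [N HN].
  specialize (HN (S N) ltac:(lia)).
  rewrite (rsumn_ext _ _ (fun k => qnrm2 (f a) * qnrm2 (qpow a k))) in HN.
  2:{ intros k _. rewrite <- qnrm2_mul. f_equal. simpl. qring. }
  rewrite (rsumn_ext _ (fun k => qnrm2 (qsumn 3 _)) (fun k => qnrm2 (qpow a k))) in HN.
  2:{ intros k _. f_equal. simpl. qring. }
  rewrite rsumn_scal in HN.
  (* The term [k = 0] makes the sum at least 1, so dividing by it does not enlarge [eps]. *)
  assert (H1 : 1 <= rsumn (S N) (fun k => qnrm2 (qpow a k))).
  { eapply Rle_trans; [|apply (rsumn_incr 1)].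
    - simpl. unfold qnrm2, qdot; simpl. lra.
    - intros; apply qnrm2_ge0.
    - lia. }
  set (s := rsumn (S N) _) in *. pose proof (qnrm2_ge0 (f a)). nra.
Qed.

(* Convexity: [(r e + d)^2 <= r e^2 + d^2 / (1 - r)]. *)
Lemma l2_recurrence r D e0 (e d : nat -> R) :
  0 <= r < 1 -> e O = e0 -> (forall k, 0 <= e k) -> (forall k, 0 <= d k) ->
  (forall k, e (S k) <= r * e k + d k) ->
  (forall n, rsumn n (fun k => d k * d k) <= D) ->
  forall n, rsumn n (fun k => e k * e k) <= (e0 * e0 + D / (1 - r)) / (1 - r).
Proof.
  intros Hr <- He Hd Hrec HD.
  assert (HD0 : 0 <= D) by (apply (HD O)).
  assert (Hr1 : 0 < / (1 - r)) by (apply Rinv_0_lt_compat; lra).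
  assert (Hstep : forall n, rsumn (S n) (fun k => e k * e k)
    <= e O * e O + r * rsumn n (fun k => e k * e k)
       + / (1 - r) * rsumn n (fun k => d k * d k)).
  { induction n as [|n IH]; [simpl; lra|].
    change (rsumn (S n) (fun k => e k * e k) + e (S n) * e (S n)
      <= e O * e O + r * (rsumn n (fun k => e k * e k) + e n * e n)
         + / (1 - r) * (rsumn n (fun k => d k * d k) + d n * d n)).
    assert (Hc : e (S n) * e (S n) <= r * (e n * e n) + / (1 - r) * (d n * d n)).
    { specialize (Hrec n).
      pose proof (He n); pose proof (Hd n); pose proof (He (S n)).
      apply Rle_trans with ((r * e n + d n) * (r * e n + d n)).
      { apply Rmult_le_compat; assumption. }
      (* With this [t], [r e + d] is the convex combination [r e + (1 - r) t]. *)
      set (t := / (1 - r) * d n).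
      assert (Et : d n = (1 - r) * t) by (unfold t; field; lra).
      replace (/ (1 - r) * (d n * d n)) with ((1 - r) * (t * t))
        by (unfold t; field; lra).
      rewrite Et.
      assert (0 <= r * (1 - r) * ((e n - t) * (e n - t))).
      { apply Rmult_le_pos; [apply Rmult_le_pos; lra|].
        change (0 <= Rsqr (e n - t)). apply Rle_0_sqr. }
      nra. }
    lra. }
  assert (HB : 0 <= (e O * e O + D / (1 - r)) / (1 - r)).
  { unfold Rdiv. apply Rmult_le_pos; [|lra].
    apply Rplus_le_le_0_compat; [|apply Rmult_le_pos; lra].
    change (0 <= Rsqr (e O)). apply Rle_0_sqr. }
  induction n as [|n IH]; [exact HB|].
  eapply Rle_trans; [apply Hstep|].
  (* The claimed bound is the fixed point of the recursion [Hstep] for the partial sums. *)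
  apply Rle_trans with (e O * e O
    + r * ((e O * e O + D / (1 - r)) / (1 - r)) + / (1 - r) * D).
  { apply Rplus_le_compat.
    - apply Rplus_le_compat_l, Rmult_le_compat_l; [lra|exact IH].
    - apply Rmult_le_compat_l; [lra|apply HD]. }
  right. field. lra.
Qed.

(** First and, below, second divided differences of [z^k]: the complete homogeneous symmetric
    polynomials of degree [k - 1] and [k - 2], zero for smaller [k]. The recursion involves no
    quotient, so nodes may coincide, and it has the shape required by [l2_recurrence]. *)
Fixpoint div_diff1 (a b : C) (k : nat) : C :=
  match k with
  | O => RtoC 0
  | S k' => Cplus (Cmult b (div_diff1 a b k')) (Cpow a k')
  end.

Fixpoint div_diff2 (a b c : C) (k : nat) : C :=
  match k with
  | O => RtoC 0
  | S k' => Cplus (Cmult c (div_diff2 a b c k')) (div_diff1 a b k')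
  end.

Lemma div_diff1_spec a b k :
  Cmult (Cminus a b) (div_diff1 a b k) = Cminus (Cpow a k) (Cpow b k).
Proof.
  induction k as [|k IH]; [simpl; ring|].
  cbn [div_diff1]. rewrite !Cpow_S.
  transitivity (Cplus (Cmult b (Cmult (Cminus a b) (div_diff1 a b k)))
    (Cmult (Cminus a b) (Cpow a k))); [ring|]. rewrite IH. ring.
Qed.

Lemma div_diff2_spec a b c k :
  Cplus (Cplus (Cmult (Cpow a k) (Cminus b c)) (Cmult (Cpow b k) (Cminus c a)))
        (Cmult (Cpow c k) (Cminus a b))
  = Copp (Cmult (Cmult (Cmult (Cminus a b) (Cminus b c)) (Cminus c a))
                (div_diff2 a b c k)).
Proof.
  induction k as [|k IH]; [simpl; ring|].
  cbn [div_diff2]. rewrite !Cpow_S.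
  transitivity (Cplus
    (Cmult c (Cplus (Cplus (Cmult (Cpow a k) (Cminus b c)) (Cmult (Cpow b k) (Cminus c a)))
        (Cmult (Cpow c k) (Cminus a b))))
    (Cmult (Cmult (Cminus a c) (Cminus b c)) (Cminus (Cpow a k) (Cpow b k)))); [ring|].
  rewrite IH, <- div_diff1_spec. ring.
Qed.

(** Three uses of [l2_recurrence], for powers, first and second divided differences. Each constant
    is the output for the preceding one and depends on [r] alone, not on the nodes. *)
Lemma div_diff2_l2 r : 0 <= r < 1 -> exists B, 0 <= B /\
  forall a b c, Cmod a <= r -> Cmod b <= r -> Cmod c <= r ->
  forall n, rsumn n (fun k => Cmod (div_diff2 a b c k) * Cmod (div_diff2 a b c k)) <= B.
Proof.
  intros Hr.
  set (B0 := (1 * 1 + 0 / (1 - r)) / (1 - r)).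
  set (B1 := (0 * 0 + B0 / (1 - r)) / (1 - r)).
  set (B2 := (0 * 0 + B1 / (1 - r)) / (1 - r)).
  exists B2.
  assert (H : forall a b c, Cmod a <= r -> Cmod b <= r -> Cmod c <= r ->
    forall n, rsumn n (fun k => Cmod (div_diff2 a b c k) * Cmod (div_diff2 a b c k)) <= B2).
  { intros a b c Ha Hb Hc.
    assert (H0 : forall n, rsumn n (fun k => Cmod (Cpow a k) * Cmod (Cpow a k)) <= B0).
    { intros n. unfold B0.
      apply (l2_recurrence r 0 1 (fun k => Cmod (Cpow a k)) (fun _ => 0)).
      - assumption.
      - apply Cmod_1.
      - intros; apply Cmod_ge_0.
      - intros; lra.
      - intros k. rewrite Cpow_S, Cmod_mult.
        pose proof (Cmod_ge_0 (Cpow a k)). nra.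
      - intros m. rewrite rsumn_const. lra. }
    assert (H1 : forall n, rsumn n (fun k => Cmod (div_diff1 a b k) * Cmod (div_diff1 a b k)) <= B1).
    { intros n. unfold B1.
      apply (l2_recurrence r B0 0 (fun k => Cmod (div_diff1 a b k)) (fun k => Cmod (Cpow a k)));
        try assumption; try apply Cmod_0; try (intros; apply Cmod_ge_0).
      intros k. cbn [div_diff1]. eapply Rle_trans; [apply Cmod_triangle|].
      rewrite Cmod_mult. apply Rplus_le_compat_r, Rmult_le_compat_r; [apply Cmod_ge_0|assumption]. }
    intros n. unfold B2.
    apply (l2_recurrence r B1 0 (fun k => Cmod (div_diff2 a b c k)) (fun k => Cmod (div_diff1 a b k)));
      try assumption; try apply Cmod_0; try (intros; apply Cmod_ge_0).
    intros k. cbn [div_diff2]. eapply Rle_trans; [apply Cmod_triangle|].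
    rewrite Cmod_mult. apply Rplus_le_compat_r, Rmult_le_compat_r; [apply Cmod_ge_0|assumption]. }
  split; [|exact H].
  apply (H 0 0 0) with (n := O); rewrite Cmod_0; lra.
Qed.

(** On the right of the Pick inequality the weights turn [z^k] into [- Q] times its second divided
    difference. These are square summable in [k], uniformly for nodes in [|z| <= r] with [r < 1],
    whence [K = sqrt B]. *)
Lemma pick_three_point f u r :
  (forall z1 z2 z3 : quat, in_ball z1 -> in_ball z2 -> in_ball z3 ->
     dual_pick3_psd f z1 z2 z3) ->
  im_unit u -> 0 <= r < 1 ->
  exists K, 0 <= K /\ three_point u r K (fun z => f (emb u z)).
Proof.
  intros hP Hu Hr. destruct (div_diff2_l2 r Hr) as [B [HB HD]].
  exists (sqrt B). split; [apply sqrt_pos|].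
  intros a b c Ha Hb Hc.
  assert (Hball : forall z, Cmod z <= r -> in_ball (emb u z)).
  { intros z Hz. unfold in_ball. rewrite qnorm_emb by assumption. lra. }
  destruct (hP _ _ _ (Hball a Ha) (Hball b Hb) (Hball c Hc)) as [P [HS HP]].
  set (x := pts3 (emb u (Cminus b c)) (emb u (Cminus c a)) (emb u (Cminus a b))).
  set (z := pts3 (emb u a) (emb u b) (emb u c)) in *.
  set (Q := Cmult (Cmult (Cminus a b) (Cminus b c)) (Cminus c a)).
  apply qnorm_le.
  { apply Rmult_le_pos; [apply sqrt_pos|].
    repeat apply Rmult_le_pos; apply Cmod_ge_0. }
  rewrite <- !Cmod_mult. fold Q.
  replace (sqrt B * Cmod Q * (sqrt B * Cmod Q)) with ((Cmod Q * Cmod Q) * B)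
    by (rewrite <- (sqrt_sqrt B) at 1 by assumption; ring).
  apply le_epsilon. intros eps He.
  destruct (pick_inequality 3 f z P x HS HP eps He) as [N HN].
  specialize (HN (S N) ltac:(lia)).
  eapply Rle_trans; [|eapply Rle_trans; [apply HN|]].
  - eapply Rle_trans; [|apply (rsumn_incr 1)].
    + simpl. rewrite Rplus_0_l. right. f_equal. unfold act. qring.
    + intros; apply qnrm2_ge0.
    + lia.
  - apply Rplus_le_compat_r.
    rewrite (rsumn_ext _ _ (fun k => (Cmod Q * Cmod Q)
      * (Cmod (div_diff2 a b c k) * Cmod (div_diff2 a b c k)))).
    + rewrite rsumn_scal. apply Rmult_le_compat_l.
      * apply Rmult_le_pos; apply Cmod_ge_0.
      * now apply HD.
    + intros k _. rewrite <- qnorm_sqr.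
      replace (qsumn 3 (fun i => qmul (qpow (z i) k) (x i)))
        with (emb u (Copp (Cmult Q (div_diff2 a b c k)))).
      * rewrite qnorm_emb, Cmod_opp, Cmod_mult by assumption. ring.
      * unfold Q. rewrite <- div_diff2_spec, !emb_add, !emb_mul, !emb_pow by assumption.
        simpl. qring.
Qed.

(** The left side scales by [r] and the right side by [r^3], so the same [K] serves. *)
Lemma three_point_rescale u r K h : im_unit u -> 0 < r <= 1 -> 0 <= K ->
  three_point u r K h -> three_point u 1 K (fun z => h (Cmult (RtoC r) z)).
Proof.
  intros Hu Hr HK H a b c Ha Hb Hc.
  assert (Hm : forall z, Cmod (Cmult (RtoC r) z) = r * Cmod z).
  { intros z. rewrite Cmod_mult, Cmod_R, Rabs_pos_eq; lra. }
  assert (Hle : forall z, Cmod z <= 1 -> Cmod (Cmult (RtoC r) z) <= r).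
  { intros z Hz. rewrite Hm. nra. }
  specialize (H _ _ _ (Hle a Ha) (Hle b Hb) (Hle c Hc)).
  assert (E : forall x y, Cminus (Cmult (RtoC r) x) (Cmult (RtoC r) y)
                          = Cmult (Cminus x y) (RtoC r)) by (intros; ring).
  rewrite !E, !act_mul, <- !act_addl, qnorm_act, !Cmod_mult, Cmod_R, Rabs_pos_eq in H
    by (try assumption; lra).
  set (q := qnorm _) in *.
  set (m := Cmod (Cminus a b) * Cmod (Cminus b c) * Cmod (Cminus c a)).
  assert (Hm0 : 0 <= m) by (repeat apply Rmult_le_pos; apply Cmod_ge_0).
  replace (K * (Cmod (Cminus a b) * r * (Cmod (Cminus b c) * r) * (Cmod (Cminus c a) * r)))
    with ((K * m) * (r * r) * r) in H by (unfold m; ring).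
  apply Rmult_le_reg_r in H; [|lra].
  assert (0 <= K * m) by (apply Rmult_le_pos; assumption).
  eapply Rle_trans; [apply H|]. rewrite <- (Rmult_1_r (K * m)) at 2.
  apply Rmult_le_compat_l; [assumption|nra].
Qed.

(** The expansion on the unit disc is applied to [z |-> f(r z)], and the [k]-th coefficient is then
    divided by [r^k]. At this stage [g] may depend on both [u] and [r]. *)
Lemma slice_expansion f u r :
  (forall z1 z2 z3 : quat, in_ball z1 -> in_ball z2 -> in_ball z3 ->
     dual_pick3_psd f z1 z2 z3) ->
  im_unit u -> 0 < r < 1 ->
  exists g : nat -> quat, (forall k, qnorm (g k) * r ^ k <= 1) /\
    forall z, Cmod z < r -> eval_r g (emb u z) (f (emb u z)).
Proof.
  intros hP Hu Hr.
  destruct (pick_three_point f u r hP Hu) as [K [HK H3]]; [lra|].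
  apply three_point_rescale in H3; [|assumption|lra|assumption].
  destruct (power_series_expansion u K _ Hu HK H3) as [m [Hm1 Hm2]].
  { intros z Hz. apply (pick_bounded f hP). unfold in_ball.
    rewrite qnorm_emb, Cmod_mult, Cmod_R, Rabs_pos_eq by (try assumption; lra).
    pose proof (Cmod_ge_0 z). nra. }
  assert (Hrk : forall k, 0 < r ^ k) by (intros; apply pow_lt; lra).
  exists (fun k => act u (m k) (RtoC (/ r ^ k))). split.
  - intros k. specialize (Hrk k).
    rewrite qnorm_act, Cmod_R, Rabs_pos_eq
      by (try assumption; left; apply Rinv_0_lt_compat; assumption).
    rewrite Rmult_assoc, Rinv_l, Rmult_1_r by lra. apply Hm1.
  - intros z Hz. apply qseries_qlim.
    assert (Er : Cmult (RtoC r) (RtoC (/ r)) = RtoC 1).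
    { rewrite <- RtoC_mult. f_equal. field. lra. }
    specialize (Hm2 (Cmult z (RtoC (/ r)))).
    replace (Cmult (RtoC r) (Cmult z (RtoC (/ r)))) with z in Hm2.
    2:{ transitivity (Cmult z (Cmult (RtoC r) (RtoC (/ r)))); [rewrite Er|]; ring. }
    eapply qlim_ext; [|apply Hm2].
    + intros n. simpl. apply qsumn_ext. intros k _.
      rewrite Cpow_mult_l, <- emb_pow, <- RtoC_pow by assumption.
      rewrite pow_inv.
      change (qmul (act u (m k) (RtoC (/ r ^ k))) (emb u (Cpow z k)))
        with (act u (act u (m k) (RtoC (/ r ^ k))) (Cpow z k)).
      rewrite <- act_mul by assumption. f_equal. ring.
    + rewrite Cmod_mult, Cmod_R, Rabs_pos_eq
        by (left; apply Rinv_0_lt_compat; lra).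
      apply (Rmult_lt_reg_r r); [lra|]. rewrite Rmult_assoc, Rinv_l by lra. lra.
Qed.

(** * Uniqueness of the coefficients *)

(** The coefficients are, up to factorials, the derivatives at 0 of a function vanishing near 0.
    Convergence at [rho / 2] provides the positive radius. *)
Lemma pseries_zero_coefficients (a : nat -> R) rho : 0 < rho ->
  (forall x, Rabs x < rho -> is_pseries a x 0) -> forall k, a k = 0.
Proof.
  intros Hrho H k.
  assert (Hcv : Rbar_lt 0 (CV_radius a)).
  { apply Rbar_lt_le_trans with (Finite (rho / 2)); [simpl; lra|].
    apply Rbar_not_lt_le. intros Hlt.
    assert (Hx : Rabs (rho / 2) = rho / 2) by (apply Rabs_pos_eq; lra).
    apply (CV_disk_outside a (rho / 2)); [now rewrite Hx|].
    apply (ex_series_lim_0 (fun n => a n * (rho / 2) ^ n)).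
    exists 0. apply (proj1 (is_pseries_R a (rho / 2) 0)). apply H. lra. }
  pose proof (Derive_n_coef a k Hcv) as E.
  assert (E0 : Derive_n (PSeries a) k 0 = 0).
  { transitivity (Derive_n (fun _ : R => 0) k 0).
    - apply Derive_n_ext_loc. exists (mkposreal rho Hrho). intros y Hy.
      apply is_pseries_unique, H.
      unfold ball in Hy; simpl in Hy.
      unfold AbsRing_ball, abs, minus, plus, opp in Hy; simpl in Hy.
      now rewrite Ropp_0, Rplus_0_r in Hy.
    - destruct k; [reflexivity|]. apply Derive_n_const. }
  rewrite E0 in E. pose proof (INR_fact_neq_0 k). nra.
Qed.

Lemma qpow_real x k : qpow (mkQ x 0 0 0) k = mkQ (x ^ k) 0 0 0.
Proof.
  induction k as [|k IH]; [reflexivity|].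
  cbn [qpow]. rewrite IH. apply quat_ext; qunfold; simpl; ring.
Qed.

(** At real points the powers are real, so each of the four components is an ordinary real power
    series. Real points lie in every slice, so expansions from different slices can be compared as
    well. *)
Lemma coefficients_unique g g' rho : 0 < rho ->
  (forall x, Rabs x < rho -> exists s,
     eval_r g (mkQ x 0 0 0) s /\ eval_r g' (mkQ x 0 0 0) s) ->
  forall k, g k = g' k.
Proof.
  intros Hrho H.
  assert (L : forall p : quat -> R,
    (forall q x, p (qmul q (mkQ x 0 0 0)) = p q * x) ->
    (forall h a s, eval_r h a s ->
       Un_cv (fun n => sum_f_R0 (fun k => p (qmul (h k) (qpow a k))) n) (p s)) ->
    forall k, p (g k) = p (g' k)).
  { intros p Pm Pc k. apply Rminus_diag_uniq.
    apply (pseries_zero_coefficients (fun k => p (g k) - p (g' k)) rho Hrho).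
    intros x Hx. destruct (H x Hx) as [s [H1 H2]].
    apply Pc in H1. apply Pc in H2. apply is_pseries_R.
    replace 0 with (minus (p s) (p s)) by (apply Rminus_diag_eq; reflexivity).
    eapply is_series_ext; [|apply (is_series_minus
      (fun k => p (qmul (g k) (qpow (mkQ x 0 0 0) k)))
      (fun k => p (qmul (g' k) (qpow (mkQ x 0 0 0) k))))].
    - intros n. cbv beta. rewrite !qpow_real, !Pm. unfold minus, plus, opp; simpl. ring.
    - apply is_series_Reals. exact H1.
    - apply is_series_Reals. exact H2. }
  intros k. apply quat_ext; apply L.
  all: try (intros; qunfold; ring).
  all: intros h a s (S1 & S2 & S3 & S4); assumption.
Qed.

(** * Contractivity of the Toeplitz matrices *)

Lemma qinv_exists y : y <> q0 ->
  exists v, qmul y v = q1 /\ qmul v y = q1.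
Proof.
  intros Hy.
  assert (Hn : qnrm2 y <> 0).
  { intros E. apply Hy, qnorm_eq0. apply qnorm_unique; lra. }
  exists (qmul (qconj y) (mkQ (/ qnrm2 y) 0 0 0)).
  split; apply quat_ext; unfold qnrm2, qdot in *; qunfold; field; assumption.
Qed.

(* For [y <> 0] the series is [f (y z y^-1) y]. *)
Lemma twisted_eval f g : (forall a, in_ball a -> eval_r g a (f a)) ->
  (forall a, in_ball a -> qnorm (f a) <= 1) ->
  forall z y, in_ball z -> exists s,
    qlim (fun n => qsumn n (fun m => qmul (qmul (g m) y) (qpow z m))) s
    /\ qnorm s <= qnorm y.
Proof.
  intros He Hf z y Hz.
  destruct (Req_dec (qnorm y) 0) as [Hy|Hy].
  { apply qnorm_eq0 in Hy. subst y. exists q0. split; [|lra].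
    apply qlim_ext with (fun _ => q0); [|apply qlim_const].
    intros n. transitivity (qsumn n (fun _ => q0)); [now rewrite qsumn_0|].
    apply qsumn_ext. intros m _. qring. }
  assert (Hy0 : y <> q0) by (intros ->; apply Hy, qnorm0).
  destruct (qinv_exists y Hy0) as [v [Hv1 Hv2]].
  set (b := qmul (qmul y z) v).
  assert (Hb : in_ball b).
  { unfold in_ball, b. rewrite !qnorm_mul.
    replace (qnorm y * qnorm z * qnorm v) with (qnorm z * (qnorm y * qnorm v)) by ring.
    rewrite <- qnorm_mul, Hv1, qnorm1, Rmult_1_r. exact Hz. }
  (* Here [v] is the inverse of [y] and [b = y z v], so [y] can be moved past the powers. *)
  assert (Hp : forall m, qmul (qpow b m) y = qmul y (qpow z m)).
  { induction m as [|m IH]; [simpl; qring|].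
    cbn [qpow]. unfold b at 2.
    rewrite !qmulA, Hv2, qmul1r, <- qmulA, IH, qmulA. reflexivity. }
  exists (qmul (f b) y). split.
  - pose proof (He b Hb) as E. apply qseries_qlim in E.
    apply (qlim_mul q1 y) in E. rewrite qmul1l in E.
    eapply qlim_ext; [|apply E]. intros n. simpl. rewrite qmul1l, <- qsumn_mulr.
    apply qsumn_ext. intros m _. now rewrite !qmulA, Hp.
  - rewrite qnorm_mul. pose proof (Hf b Hb). pose proof (qnorm_ge0 y). nra.
Qed.

(** The coefficient of [z^m] in the product of [g] with the polynomial having coefficients [x_k],
    [k < n]. The index [m] may exceed [n]; the rows [m < n] are those of the matrix. *)
Definition toeplitz_apply (g : nat -> quat) (n : nat) (x : nat -> quat) (m : nat) : quat :=
  qsumn n (fun k => qmul (toeplitz g m k) (x k)).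

Lemma qlim_qsumn_shift (a : nat -> quat) s k :
  qlim (fun n => qsumn n a) s ->
  qlim (fun n => qsumn n (fun m => if Nat.leb k m then a (m - k)%nat else q0)) s.
Proof.
  intros H. apply (qlim_shift _ _ k). eapply qlim_ext; [|apply H].
  intros n. simpl. rewrite Nat.add_comm, qsumn_split.
  rewrite (qsumn_ext k _ (fun _ => q0)), qsumn_0.
  - replace (qadd q0 _) with
      (qsumn n (fun m => if Nat.leb k (k + m) then a (k + m - k)%nat else q0)) by qring.
    apply qsumn_ext. intros m _. rewrite (proj2 (Nat.leb_le k (k + m))) by lia.
    f_equal. lia.
  - intros m Hm. now rewrite (proj2 (Nat.leb_gt k m)).
Qed.

(** The product series at [z] is that of [twisted_eval] with [y = sum_k x_k z^k], because
    [x_k z^k z^m = x_k z^m z^k]. Rearranging by total degree is harmless: it splits into [n]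
    convergent series, the [k]-th shifted by [k]. *)
Lemma toeplitz_series f g : (forall a, in_ball a -> eval_r g a (f a)) ->
  (forall a, in_ball a -> qnorm (f a) <= 1) ->
  forall z n x, in_ball z -> exists s,
    qlim (fun N => qsumn N (fun m => qmul (toeplitz_apply g n x m) (qpow z m))) s
    /\ qnorm s <= qnorm (qsumn n (fun k => qmul (x k) (qpow z k))).
Proof.
  intros He Hf z n x Hz.
  set (y := qsumn n (fun k => qmul (x k) (qpow z k))).
  destruct (twisted_eval f g He Hf z y Hz) as [s [Hs1 Hs2]].
  assert (Hk : forall k, exists t, qlim (fun N => qsumn N
     (fun m => qmul (qmul (g m) (x k)) (qpow z m))) t).
  { intros k. destruct (twisted_eval f g He Hf z (x k) Hz) as [t [Ht _]]. now exists t. }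
  (* Finite choice, by induction, of the sums of the [n] separate series. *)
  assert (Hfin : forall l, exists t : nat -> quat, forall k, (k < l)%nat ->
     qlim (fun N => qsumn N (fun m => qmul (qmul (g m) (x k)) (qpow z m))) (t k)).
  { induction l as [|l [t Ht]]; [exists (fun _ => q0); intros; lia|].
    destruct (Hk l) as [t' Ht'].
    exists (fun k => if Nat.eqb k l then t' else t k). intros k Hkl.
    destruct (Nat.eqb_spec k l) as [->|]; [assumption|]. apply Ht. lia. }
  destruct (Hfin n) as [t Ht].
  assert (Es : s = qsumn n (fun k => qmul (t k) (qpow z k))).
  { eapply qlim_unique; [apply Hs1|].
    eapply qlim_ext; [|apply (qlim_qsumn n (fun k N => qmul (qmul q1 (qsumn N
       (fun m => qmul (qmul (g m) (x k)) (qpow z m)))) (qpow z k)))].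
    - intros N. simpl.
      rewrite (qsumn_ext n _ (fun k => qsumn N (fun m =>
        qmul (qmul (qmul (g m) (x k)) (qpow z m)) (qpow z k))))
        by (intros; now rewrite qmul1l, qsumn_mulr).
      rewrite qsumn_exch. apply qsumn_ext. intros m _.
      unfold y. rewrite <- qsumn_mull, <- qsumn_mulr. apply qsumn_ext. intros k _.
      rewrite !qmulA, <- !qpow_add. do 3 f_equal. lia.
    - intros k Hkn. pose proof (qlim_mul q1 (qpow z k) _ _ (Ht k Hkn)) as Q.
      rewrite qmul1l in Q. exact Q. }
  exists s. split; [|assumption]. rewrite Es.
  eapply qlim_ext; [|apply (qlim_qsumn n (fun k N => qsumn N (fun m =>
    if Nat.leb k m then qmul (qmul (qmul q1 (qmul (g (m - k)%nat) (x k)))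
       (qpow z (m - k)%nat)) (qpow z k) else q0)))].
  - intros N. simpl. rewrite qsumn_exch. apply qsumn_ext. intros m _.
    unfold toeplitz_apply. rewrite <- qsumn_mulr. apply qsumn_ext. intros k _.
    unfold toeplitz. destruct (Nat.leb_spec k m) as [Hkm|Hkm]; [|qring].
    rewrite qmul1l, !qmulA, <- qpow_add. do 3 f_equal. lia.
  - intros k Hkn.
    apply (qlim_qsumn_shift (fun m => qmul (qmul (qmul q1 (qmul (g m) (x k)))
       (qpow z m)) (qpow z k))).
    pose proof (qlim_mul q1 (qpow z k) _ _ (Ht k Hkn)) as Q.
    rewrite qmul1l in Q. eapply qlim_ext; [|apply Q].
    intros N. simpl. rewrite qmul1l, <- qsumn_mulr. apply qsumn_ext.
    intros m _. now rewrite qmul1l.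
Qed.

(** The inequality of [toeplitz_series] is averaged over [r] times the [N]-th roots of unity.
    Parseval needs a polynomial, so the product series is cut after [N] terms; the error is [O(r^N)]
    and disappears as [N] grows. *)
Lemma toeplitz_l2_radius f g : (forall a, in_ball a -> eval_r g a (f a)) ->
  (forall a, in_ball a -> qnorm (f a) <= 1) -> (forall k, qnorm (g k) <= 1) ->
  forall n x r, 0 < r < 1 ->
    rsumn n (fun m => qnrm2 (toeplitz_apply g n x m) * (r ^ m * r ^ m))
    <= rsumn n (fun k => qnrm2 (x k)).
Proof.
  intros He Hf Hg n x r Hr.
  (* Sample points in one slice suffice, since Parseval holds for arbitrary quaternionic
     coefficients. *)
  set (u := mkQ 0 1 0 0).
  assert (Hu : im_unit u) by (unfold im_unit; simpl; ring).
  set (c := toeplitz_apply g n x).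
  (* A crude common bound for all product coefficients and for the polynomial of [x] on the ball. *)
  set (X := rsumn n (fun k => qnorm (x k))).
  assert (HX : 0 <= X) by (apply rsumn_ge0; intros; apply qnorm_ge0).
  assert (Hc : forall m, qnorm (c m) <= X).
  { intros m. unfold c, toeplitz_apply. eapply Rle_trans; [apply qsumn_norm_le|].
    apply rsumn_le. intros k _. rewrite qnorm_mul.
    pose proof (qnorm_ge0 (x k)). rewrite <- (Rmult_1_l (qnorm (x k))) at 2.
    apply Rmult_le_compat_r; [assumption|].
    unfold toeplitz. destruct (Nat.leb k m); [apply Hg|rewrite qnorm0; lra]. }
  assert (Ep : forall (q : quat) N j m,
    act u (act u q (RtoC (r ^ m))) (Cpow (Cpow (zroot N) j) m)
    = qmul q (qpow (emb u (Cmult (RtoC r) (Cpow (zroot N) j))) m)).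
  { intros q N j m. rewrite <- act_mul, RtoC_pow, <- Cpow_mult_l by assumption.
    unfold act. now rewrite emb_pow. }
  assert (En : forall (q : quat) m, qnrm2 (act u q (RtoC (r ^ m))) = qnrm2 q * (r ^ m * r ^ m)).
  { intros q m. rewrite <- !qnorm_sqr, qnorm_act, Cmod_R, Rabs_pos_eq by
      (try assumption; apply pow_le; lra). ring. }
  assert (Hmain : forall N, (n <= N)%nat -> (0 < N)%nat ->
    rsumn n (fun m => qnrm2 (c m) * (r ^ m * r ^ m))
    <= rsumn n (fun k => qnrm2 (x k))
       + (2 * X + X * / (1 - r)) * (X * / (1 - r)) * r ^ N).
  { intros N HnN HN0.
    assert (HN : 0 < INR N) by (apply lt_0_INR; lia).
    set (d := X * r ^ N / (1 - r)).
    assert (HrN : 0 <= r ^ N <= 1).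
    { split; [apply pow_le; lra|]. apply pow_le_1. lra. }
    assert (Hir : 0 < / (1 - r)) by (apply Rinv_0_lt_compat; lra).
    assert (HXr : 0 <= X * / (1 - r)) by (apply Rmult_le_pos; lra).
    assert (Ed : d = X * / (1 - r) * r ^ N) by (unfold d, Rdiv; ring).
    assert (Hd : 0 <= d <= X * / (1 - r)) by (rewrite Ed; split; nra).
    pose proof (parseval u N N (fun m => act u (c m) (RtoC (r ^ m))) Hu (Nat.le_refl N)) as P1.
    pose proof (parseval u N n (fun m => act u (x m) (RtoC (r ^ m))) Hu HnN) as P2.
    cbv beta in P1, P2.
    (* With [p] the truncated product and [y] the polynomial of [x], [|p| <= |y| + d] and [|y| <= X]
       give [|p|^2 <= |y|^2 + (2 X + d) d]. *)
    assert (Hj : forall j,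
      qnrm2 (qsumn N (fun m => act u (act u (c m) (RtoC (r ^ m))) (Cpow (Cpow (zroot N) j) m)))
      <= qnrm2 (qsumn n (fun m => act u (act u (x m) (RtoC (r ^ m))) (Cpow (Cpow (zroot N) j) m)))
         + (2 * X + d) * d).
    { intros j.
      set (z := emb u (Cmult (RtoC r) (Cpow (zroot N) j))).
      assert (Hz : qnorm z = r).
      { unfold z. rewrite qnorm_emb, Cmod_mult, Cmod_zroot_pow, Cmod_R, Rabs_pos_eq
          by (try assumption; lra). ring. }
      rewrite (qsumn_ext N _ (fun m => qmul (c m) (qpow z m))) by (intros; apply Ep).
      rewrite (qsumn_ext n _ (fun m => qmul (x m) (qpow z m))) by (intros; apply Ep).
      destruct (toeplitz_series f g He Hf z n x) as [s [Hs1 Hs2]].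
      { unfold in_ball. lra. }
      assert (Ht : qnorm (qsub s (qsumn N (fun m => qmul (c m) (qpow z m)))) <= d).
      { apply qlim_geometric_tail; [lra| |exact Hs1].
        intros k. rewrite qnorm_mul, qnorm_pow, Hz.
        apply Rmult_le_compat_r; [apply pow_le; lra|apply Hc]. }
      rewrite qnorm_sub_sym in Ht.
      pose proof (qnorm_le_sub (qsumn N (fun m => qmul (c m) (qpow z m))) s) as Hq.
      assert (Hy : qnorm (qsumn n (fun k => qmul (x k) (qpow z k))) <= X).
      { eapply Rle_trans; [apply qsumn_norm_le|]. apply rsumn_le. intros k _.
        rewrite qnorm_mul, qnorm_pow, Hz. pose proof (qnorm_ge0 (x k)).
        assert (r ^ k <= 1) by (apply pow_le_1; lra).
        nra. }
      rewrite <- !qnorm_sqr.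
      pose proof (qnorm_ge0 (qsumn N (fun m => qmul (c m) (qpow z m)))).
      pose proof (qnorm_ge0 (qsumn n (fun k => qmul (x k) (qpow z k)))).
      set (p := qnorm (qsumn N _)) in *. set (y := qnorm (qsumn n _)) in *.
      assert (p <= y + d) by lra. nra. }
    assert (Hsum := rsumn_le N _ _ (fun j _ => Hj j)).
    cbv beta in Hsum. rewrite rsumn_add, rsumn_const, P1, P2 in Hsum.
    rewrite <- Rmult_plus_distr_l in Hsum. apply Rmult_le_reg_l in Hsum; [|assumption].
    assert (H1 : rsumn n (fun m => qnrm2 (c m) * (r ^ m * r ^ m))
      <= rsumn N (fun m => qnrm2 (act u (c m) (RtoC (r ^ m))))).
    { rewrite (rsumn_ext n _ (fun m => qnrm2 (act u (c m) (RtoC (r ^ m)))))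
        by (intros; now rewrite En).
      apply rsumn_incr; [intros; apply qnrm2_ge0|assumption]. }
    assert (H2 : rsumn n (fun m => qnrm2 (act u (x m) (RtoC (r ^ m))))
      <= rsumn n (fun k => qnrm2 (x k))).
    { apply rsumn_le. intros k _. rewrite En. pose proof (qnrm2_ge0 (x k)).
      assert (0 <= r ^ k <= 1).
      { split; [apply pow_le; lra|]. apply pow_le_1. lra. }
      rewrite <- (Rmult_1_r (qnrm2 (x k))) at 2.
      apply Rmult_le_compat_l; [assumption|nra]. }
    assert (H3 : (2 * X + d) * d
      <= (2 * X + X * / (1 - r)) * (X * / (1 - r)) * r ^ N).
    { rewrite Rmult_assoc, <- Ed. apply Rmult_le_compat_r; lra. }
    lra. }
  apply le_epsilon. intros eps Heps.
  assert (HXr : 0 <= X * / (1 - r)).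
  { apply Rmult_le_pos; [assumption|]. left. apply Rinv_0_lt_compat. lra. }
  destruct (pow_small r ((2 * X + X * / (1 - r)) * (X * / (1 - r))) eps) as [N HN];
    [lra|apply Rmult_le_pos; lra|assumption|].
  specialize (Hmain (S (n + N)) ltac:(lia) ltac:(lia)).
  specialize (HN (S (n + N)) ltac:(lia)). lra.
Qed.

Lemma bernoulli_pow d n : 0 <= d <= 1 -> 1 - INR n * d <= (1 - d) ^ n.
Proof.
  intros Hd. induction n as [|n IH]; [simpl; lra|].
  rewrite S_INR. simpl. pose proof (pos_INR n).
  assert ((1 - INR n * d) * (1 - d) <= (1 - d) ^ n * (1 - d))
    by (apply Rmult_le_compat_r; lra).
  nra.
Qed.

(** The limit [r -> 1], made quantitative by Bernoulli's inequality; [d] is chosen so that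
    [0 < d < 1] and [A n d <= eps]. *)
Lemma le_of_pow_scaled A B n : 0 <= A ->
  (forall r, 0 < r < 1 -> A * r ^ n <= B) -> A <= B.
Proof.
  intros HA H. apply le_epsilon. intros eps Heps.
  pose proof (pos_INR n) as HM. set (M := INR n) in *.
  assert (HAM : 0 <= A * M) by (apply Rmult_le_pos; assumption).
  set (d := eps / (A * M + 2 * eps + 1)).
  assert (Hd : 0 < d < 1).
  { unfold d. split; [apply Rdiv_lt_0_compat; lra|].
    apply (Rmult_lt_reg_r (A * M + 2 * eps + 1)); [lra|].
    unfold Rdiv. rewrite Rmult_assoc, Rinv_l by lra. lra. }
  specialize (H (1 - d) ltac:(lra)).
  assert (Hb : A * (1 - M * d) <= A * (1 - d) ^ n).
  { apply Rmult_le_compat_l; [assumption|]. apply bernoulli_pow. lra. }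
  assert (A * M * d <= eps).
  { unfold d. apply (Rmult_le_reg_r (A * M + 2 * eps + 1)); [lra|].
    replace (A * M * (eps / (A * M + 2 * eps + 1)) * (A * M + 2 * eps + 1))
      with (A * M * eps) by (field; lra). nra. }
  lra.
Qed.

Lemma toeplitz_l2 f g : (forall a, in_ball a -> eval_r g a (f a)) ->
  (forall a, in_ball a -> qnorm (f a) <= 1) -> (forall k, qnorm (g k) <= 1) ->
  forall n x, rsumn n (fun m => qnrm2 (toeplitz_apply g n x m))
              <= rsumn n (fun k => qnrm2 (x k)).
Proof.
  (* For [m < n] every weight [r^m r^m] is at least [r^(2n)], so a single power can be factored out
     of the sum. *)
  intros He Hf Hg n x. apply (le_of_pow_scaled _ _ (2 * n)).
  { apply rsumn_ge0; intros; apply qnrm2_ge0. }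
  intros r Hr.
  eapply Rle_trans; [|apply (toeplitz_l2_radius f g He Hf Hg n x r Hr)].
  rewrite Rmult_comm, <- rsumn_scal. apply rsumn_le. intros m Hm.
  rewrite Rmult_comm. apply Rmult_le_compat_l; [apply qnrm2_ge0|].
  rewrite <- pow_add. replace (2 * n)%nat with ((m + m) + (2 * n - (m + m)))%nat by lia.
  rewrite pow_add. rewrite <- (Rmult_1_r (r ^ (m + m))) at 2.
  apply Rmult_le_compat_l; [apply pow_le; lra|]. apply pow_le_1. lra.
Qed.

(** * Adjoints of contractions and positive semidefiniteness *)

Lemma qdot_le_half a b : qdot a b <= / 2 * (qnrm2 a + qnrm2 b).
Proof.
  assert (H := qnrm2_ge0 (qsub a b)).
  replace (qnrm2 (qsub a b)) with (qnrm2 a + qnrm2 b - 2 * qdot a b) in H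
    by (unfold qnrm2, qdot; qunfold; ring).
  lra.
Qed.

(** With [w] the adjoint of [T] applied to [y], [|w|^2] is the real inner product of [T w] and [y],
    at most half of [|T w|^2 + |y|^2], hence at most half of [|w|^2 + |y|^2]. *)
Lemma adjoint_contraction n (T : qmat) :
  (forall x, rsumn n (fun i => qnrm2 (qsumn n (fun l => qmul (T i l) (x l))))
             <= rsumn n (fun l => qnrm2 (x l))) ->
  forall y, rsumn n (fun l => qnrm2 (qsumn n (fun i => qmul (qconj (T i l)) (y i))))
            <= rsumn n (fun i => qnrm2 (y i)).
Proof.
  intros H y.
  set (w := fun l => qsumn n (fun i => qmul (qconj (T i l)) (y i))).
  specialize (H w).
  assert (E : rsumn n (fun l => qnrm2 (w l))
    = rsumn n (fun i => qdot (qsumn n (fun l => qmul (T i l) (w l))) (y i))).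
  { rewrite (rsumn_ext n (fun i => qdot (qsumn n _) (y i))
      (fun i => rsumn n (fun l => qdot (qmul (T i l) (w l)) (y i))))
      by (intros; apply qdot_qsumn_l).
    rewrite rsumn_exch. apply rsumn_ext. intros l _.
    unfold qnrm2. unfold w at 2. rewrite qdot_qsumn_r. apply rsumn_ext. intros i _.
    unfold qdot; qunfold; ring. }
  assert (L : rsumn n (fun i => qdot (qsumn n (fun l => qmul (T i l) (w l))) (y i))
    <= / 2 * (rsumn n (fun i => qnrm2 (qsumn n (fun l => qmul (T i l) (w l))))
              + rsumn n (fun i => qnrm2 (y i)))).
  { rewrite <- rsumn_add, <- rsumn_scal. apply rsumn_le. intros i _.
    apply qdot_le_half. }
  change (rsumn n (fun l => qnrm2 (w l)) <= rsumn n (fun i => qnrm2 (y i))).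
  lra.
Qed.

Lemma qconj_mul_self a : qmul (qconj a) a = mkQ (qnrm2 a) 0 0 0.
Proof. apply quat_ext; unfold qnrm2, qdot; qunfold; ring. Qed.

Lemma qsumn_real n f : qsumn n (fun k => mkQ (f k) 0 0 0) = mkQ (rsumn n f) 0 0 0.
Proof.
  induction n as [|n IH]; [reflexivity|]. simpl. rewrite IH.
  apply quat_ext; qunfold; ring.
Qed.

Lemma qsumn_delta n m f : (m < n)%nat ->
  (forall k, (k < n)%nat -> k <> m -> f k = q0) -> qsumn n f = f m.
Proof.
  intros Hm H.
  assert (L : forall p : quat -> R, p q0 = 0 ->
    rsumn n (fun k => p (f k)) = p (f m)).
  { intros p Hp. apply (rsumn_delta n m (fun k => p (f k)) Hm).
    intros k Hk Hne. now rewrite H. }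
  apply quat_ext; rewrite ?qr_qsumn, ?qi_qsumn, ?qj_qsumn, ?qk_qsumn; now apply L.
Qed.

(** The quadratic form at [x] is the real number [|x|^2 - |w|^2], where [w] is the adjoint of [T]
    applied to [x]. *)
Lemma id_minus_TTstar_psd n (T : qmat) :
  (forall y, rsumn n (fun l => qnrm2 (qsumn n (fun i => qmul (qconj (T i l)) (y i))))
             <= rsumn n (fun i => qnrm2 (y i))) ->
  qpsd n (id_minus_TTstar n T).
Proof.
  intros H. split.
  - intros i j _ _. unfold id_minus_TTstar.
    replace (qconj (qsub (if Nat.eqb j i then q1 else q0)
        (qsumn n (fun l => qmul (T j l) (qconj (T i l))))))
      with (qsub (if Nat.eqb j i then q1 else q0)
        (qconj (qsumn n (fun l => qmul (T j l) (qconj (T i l))))))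
      by (destruct (Nat.eqb j i); qring).
    rewrite qsumn_conj, (Nat.eqb_sym j i). f_equal. apply qsumn_ext. intros l _.
    now rewrite qconj_mul, qconjK.
  - intros x. set (w := fun l => qsumn n (fun i => qmul (qconj (T i l)) (x i))).
    assert (E : qsumn n (fun i => qsumn n (fun j =>
       qmul (qmul (qconj (x i)) (id_minus_TTstar n T i j)) (x j)))
      = mkQ (rsumn n (fun i => qnrm2 (x i)) - rsumn n (fun l => qnrm2 (w l))) 0 0 0).
    { rewrite (qsumn_ext n _ (fun i => qsub (mkQ (qnrm2 (x i)) 0 0 0)
        (qsumn n (fun l => qsumn n (fun j =>
           qmul (qconj (qmul (qconj (T i l)) (x i))) (qmul (qconj (T j l)) (x j))))))).
      - rewrite qsumn_sub, qsumn_real, qsumn_exch.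
        rewrite (qsumn_ext n (fun j => qsumn n _) (fun l => mkQ (qnrm2 (w l)) 0 0 0)).
        + rewrite qsumn_real. apply quat_ext; qunfold; ring.
        + intros l _. now rewrite qsumn_gram, qconj_mul_self.
      - intros i Hi. unfold id_minus_TTstar.
        rewrite (qsumn_ext n _ (fun j => qsub
          (qmul (qmul (qconj (x i)) (if Nat.eqb i j then q1 else q0)) (x j))
          (qsumn n (fun l => qmul (qconj (qmul (qconj (T i l)) (x i)))
                               (qmul (qconj (T j l)) (x j)))))).
        + rewrite qsumn_sub. f_equal; [|apply qsumn_exch].
          rewrite (qsumn_delta n i); [|assumption|].
          * rewrite Nat.eqb_refl, qmul1r. apply qconj_mul_self.
          * intros j _ Hne. rewrite (proj2 (Nat.eqb_neq i j)) by auto. qring.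
        + intros j _.
          rewrite (qsumn_ext n (fun l => qmul (qconj _) _)
            (fun l => qmul (qmul (qconj (x i)) (qmul (T i l) (qconj (T j l)))) (x j))).
          2:{ intros l _. now rewrite qconj_mul, qconjK, !qmulA. }
          rewrite qsumn_mulr, qsumn_mull. qring. }
    rewrite E. cbn [qr qi qj qk]. specialize (H x). fold w in H.
    change (rsumn n (fun l => qnrm2 (w l)) <= rsumn n (fun i => qnrm2 (x i))) in H.
    repeat split; lra.
Qed.

(** * Gluing the slices and conclusion *)

Lemma quat_in_slice a : exists u z, im_unit u /\ a = emb u z.
Proof.
  set (y := qnorm (mkQ 0 (qi a) (qj a) (qk a))).
  assert (Hy2 : y * y = qi a * qi a + qj a * qj a + qk a * qk a).
  { unfold y. rewrite qnorm_sqr. unfold qnrm2, qdot; simpl. ring. }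
  destruct (Req_dec y 0) as [Hy|Hy].
  (* A real quaternion lies in every slice; the unit is an arbitrary choice. *)
  - exists (mkQ 0 1 0 0), (qr a, 0). split; [unfold im_unit; simpl; ring|].
    rewrite Hy in Hy2. unfold emb; simpl.
    apply quat_ext; simpl; nra.
  - exists (mkQ 0 (qi a / y) (qj a / y) (qk a / y)), (qr a, y). split.
    + unfold im_unit; simpl.
      transitivity ((qi a * qi a + qj a * qj a + qk a * qk a) / (y * y)).
      * field. assumption.
      * rewrite <- Hy2. field. assumption.
    + unfold emb; apply quat_ext; simpl; try field; auto.
Qed.

Lemma radius_ge1_bounded g : (forall k, qnorm (g k) <= 1) -> radius_ge1 g.
Proof.
  intros H eps He. exists O. intros k _. eapply Rle_trans; [apply H|].
  apply pow_R1_Rle. lra.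
Qed.

Theorem theorem3p2 (f : quat -> quat)
  (hP : forall z1 z2 z3 : quat, in_ball z1 -> in_ball z2 -> in_ball z3 ->
          dual_pick3_psd f z1 z2 z3) :
  exists g : nat -> quat,
    QS g /\
    (forall a : quat, in_ball a -> eval_r g a (f a)) /\
    (forall g' : nat -> quat, QS g' ->
       (forall a : quat, in_ball a -> eval_r g' a (f a)) ->
       forall k, g' k = g k).
Proof.
  assert (Hi : im_unit (mkQ 0 1 0 0)) by (unfold im_unit; simpl; ring).
  (* One slice and one radius fix the candidate [g]; both choices are arbitrary. *)
  destruct (slice_expansion f _ (1 / 2) hP Hi) as [g [_ Hg]]; [lra|].
  assert (Hreal : forall u x, mkQ x 0 0 0 = emb u (RtoC x)).
  { intros u x. unfold emb; apply quat_ext; simpl; ring. }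
  (* Any other slice and radius give the same coefficients, by comparison at the real points common
     to both discs. *)
  assert (Hsame : forall u r, im_unit u -> 0 < r < 1 ->
    (forall k, qnorm (g k) * r ^ k <= 1) /\
    (forall z, Cmod z < r -> eval_r g (emb u z) (f (emb u z)))).
  { intros u r Hu Hr. destruct (slice_expansion f u r hP Hu Hr) as [g1 [H1 H2]].
    assert (E : forall k, g k = g1 k).
    { apply (coefficients_unique g g1 (Rmin (1 / 2) r)).
      - apply Rmin_glb_lt; lra.
      - intros x Hx. exists (f (mkQ x 0 0 0)).
        pose proof (Rmin_l (1 / 2) r). pose proof (Rmin_r (1 / 2) r). split.
        + rewrite (Hreal (mkQ 0 1 0 0)). apply Hg. rewrite Cmod_R. lra.
        + rewrite (Hreal u). apply H2. rewrite Cmod_R. lra. }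
    split.
    - intros k. rewrite E. apply H1.
    - intros z Hz. apply qseries_qlim. specialize (H2 z Hz).
      apply qseries_qlim in H2. eapply qlim_ext; [|apply H2].
      intros n. apply qsumn_ext. intros k _. now rewrite E. }
  assert (Heval : forall a, in_ball a -> eval_r g a (f a)).
  { intros a Ha. destruct (quat_in_slice a) as [u [z [Hu ->]]].
    unfold in_ball in Ha. rewrite qnorm_emb in Ha by assumption.
    pose proof (Cmod_ge_0 z).
    (* The midpoint lies strictly between [|z|] and 1. *)
    apply (Hsame u ((1 + Cmod z) / 2) Hu); lra. }
  assert (Hg1 : forall k, qnorm (g k) <= 1).
  (* As [g] no longer depends on [r], the limit [r -> 1] can be taken in [|g_k| r^k <= 1]. *)
  { intros k. apply (le_of_pow_scaled _ _ k); [apply qnorm_ge0|].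
    intros r Hr. now apply (Hsame _ r Hi). }
  exists g. split; [|split].
  - split; [now apply radius_ge1_bounded|].
    intros n _. apply id_minus_TTstar_psd. apply adjoint_contraction.
    apply (toeplitz_l2 f g Heval (pick_bounded f hP) Hg1 n).
  - exact Heval.
  - intros g' _ Hg' k. symmetry.
    apply (coefficients_unique g g' 1); [lra|].
    intros x Hx. exists (f (mkQ x 0 0 0)).
    assert (Hb : in_ball (mkQ x 0 0 0)).
    { unfold in_ball. now rewrite (Hreal (mkQ 0 1 0 0)), qnorm_emb, Cmod_R. }
    split; [apply Heval|apply Hg']; assumption.
Qed.
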